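(* Let $(M,g)$ be a $4$-dimensional spacetime threaded by a (not necessarily normalized) timelike vector field $\xi=\partial/\partial x^0$, with the notation of the context, let $T$ be the energy-momentum tensor field $$T(X,Y)=\rho\,u(X)u(Y)+q(X)u(Y)+q(Y)u(X)+p\,\bar g(X,Y)+\pi(X,Y),$$ and let $\Lambda,\mathbf G$ be constants (the cosmological constant and the Newton constant). Then the Einstein field equations $$G(X,Y)+\Lambda g(X,Y)=8\pi\mathbf G\,T(X,Y)\qquad\forall X,Y\in\Gamma(TM),$$ where $G=\mathrm{Ric}-\tfrac12\mathbf R\,g$, split into the following three groups of equations ($i,j\in\{1,2,3\}$). (Spatial equations) $$\begin{aligned}&\bar G_{ij}+\Big(b^2+b^k{}_{|k}+\tfrac12\Phi^2\omega^2+\Lambda\Big)\bar g_{ij}-\tfrac12\big(b_{i|j}+b_{j|i}\big)-b_ib_j\\&\quad+\Phi^{-2}\Big\{(\Theta-\Psi)\Theta_{ij}+\Theta_{ij|0}-\Big(\Theta_{|0}-\Psi\Theta+\tfrac23\Theta^2+\tfrac12\sigma^2\Big)\bar g_{ij}\Big\}=8\pi\mathbf G\,(p\,\bar g_{ij}+\pi_{ij}).\end{aligned}$$ (Mixed equations) either of the two forms $$\bar R_{i\ 0k}^{\ k}+\Theta b_i-\Theta_{ik}b^k-\Phi^2\omega_{ik}b^k=-8\pi\mathbf G\,\Phi\,q_i,$$ $$\Theta^k_{i|k}-\Theta_{|i}+\Theta c_i-\Theta_{ik}c^k-\Phi^2\big(\omega^k_{i|k}+c_k\omega^k_i-2\omega_{ik}b^k\big)=-8\pi\mathbf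 G\,\Phi\,q_i.$$ (Temporal equation) $$\Phi^2\bar{\mathbf R}+\tfrac23\Theta^2-\sigma^2+\Phi^4\omega^2=2\Phi^2(\Lambda+8\pi\mathbf G\rho).$$
   Context: Indices $i,j,k,h,l$ run over $\{1,2,3\}$; the summation convention is used. $(M,g)$ is a $4$-dimensional spacetime with Lorentz metric of signature $(-,+,+,+)$, Levi-Civita connection $\nabla$, Ricci tensor $\mathrm{Ric}$ and scalar curvature $\mathbf R$. $\xi$ is a timelike vector field; $TM=VM\oplus SM$, where $VM$ is spanned by $\xi$ and the spatial distribution $SM$ (not assumed integrable) is its orthogonal complement; $\mathcal S$ denotes the projection onto $SM$. Local coordinates $(x^0,x^i)$ are chosen with $\xi=\partial/\partial x^0$. Put $g(\partial_{x^0},\partial_{x^0})=-\Phi^2$ with $\Phi$ a nowhere zero function, $\xi_i=g(\partial_{x^i},\partial_{x^0})$, $A_i=-\Phi^{-2}\xi_i$, and $\frac{\delta}{\delta x^i}=\frac{\partial}{\partial x^i}-A_i\frac{\partial}{\partial x^0}$ (a local frame of $SM$). Define $$\omega_{ij}=\tfrac12\Big(\frac{\delta A_j}{\delta x^i}-\frac{\delta A_i}{\delta x^j}\Big),\quad a_i=-\frac{\partial A_i}{\partial x^0},\quad c_i=\Phi^{-1}\frac{\delta\Phi}{\delta x^i},\quad b_i=a_i+c_i,\quad \Psi=\Phi^{-1}\frac{\partial\Phi}{\partial x^0},$$ $$\bar g_{ij}=g\Big(\frac{\delta}{\delta x^i},\frac{\delta}{\delta x^j}\Big),\quad \Theta_{ij}=\tfrac12\frac{\partial\bar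 g_{ij}}{\partial x^0},\quad \Theta=\bar g^{ij}\Theta_{ij},\quad \sigma_{ij}=\Theta_{ij}-\tfrac13\Theta\bar g_{ij},\quad K_{ij}=\Theta_{ij}+\Phi^2\omega_{ij}.$$ Indices are raised and lowered with $\bar g$; for mixed components the first index is raised: $\omega^k_j=\bar g^{ki}\omega_{ij}$, $K^k_j=\bar g^{ki}K_{ij}=\Theta^k_j+\Phi^2\omega^k_j$. Also $\sigma^2=\sigma_{hk}\sigma^{hk}$, $\omega^2=\omega_{hk}\omega^{hk}$, $b^2=b_kb^k$. The Riemannian spatial connection is the metric connection on $SM$ given by $\bar\nabla_X\mathcal SY=\mathcal S\nabla_X\mathcal SY$; locally $\bar\nabla_{\delta/\delta x^j}\frac{\delta}{\delta x^i}=\bar\Gamma^{\ k}_{i\ j}\frac{\delta}{\delta x^k}$ and $\bar\nabla_{\partial/\partial x^0}\frac{\delta}{\delta x^i}=K^k_i\frac{\delta}{\delta x^k}$, with $\bar\Gamma^{\ k}_{i\ j}=\tfrac12\bar g^{kh}\big(\frac{\delta\bar g_{hj}}{\delta x^i}+\frac{\delta\bar g_{hi}}{\delta x^j}-\frac{\delta\bar g_{ij}}{\delta x^h}\big)$. A vertical bar denotes the induced covariant derivatives of spatial tensor fields, e.g. $T^j_{i|k}=\frac{\delta T^j_i}{\delta x^k}+T^h_i\bar\Gamma^{\ j}_{h\ k}-T^j_h\bar\Gamma^{\ h}_{i\ k}$ and $T^j_{i|0}=\frac{\partial T^j_i}{\partial x^0}+T^h_iK^j_h-T^j_hK^h_i$;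 for functions $f_{|k}=\delta f/\delta x^k$, $f_{|0}=\partial f/\partial x^0$. The curvature of $\bar\nabla$ is $\bar R(X,Y,Z)=\bar\nabla_X\bar\nabla_Y\mathcal SZ-\bar\nabla_Y\bar\nabla_X\mathcal SZ-\bar\nabla_{[X,Y]}\mathcal SZ$, with components $\bar R\big(\frac{\delta}{\delta x^k},\frac{\delta}{\delta x^j},\frac{\delta}{\delta x^i}\big)=\bar R_{i\ jk}^{\ h}\frac{\delta}{\delta x^h}$ and $\bar R\big(\frac{\delta}{\delta x^k},\frac{\partial}{\partial x^0},\frac{\delta}{\delta x^i}\big)=\bar R_{i\ 0k}^{\ h}\frac{\delta}{\delta x^h}$. Put $\bar R_{ij}=\tfrac12(\bar R_{i\ jk}^{\ k}+\bar R_{j\ ik}^{\ k})$ (spatial Ricci tensor), $\bar{\mathbf R}=\bar g^{ij}\bar R_{ij}$ (spatial scalar curvature), $\bar G_{ij}=\bar R_{ij}-\tfrac12\bar{\mathbf R}\,\bar g_{ij}$. In $T$: $U=\Phi^{-1}\partial/\partial x^0$ and $u(X)=\Phi^{-1}g(X,\partial/\partial x^0)=g(X,U)$; $\bar g(X,Y)=g(\mathcal SX,\mathcal SY)$; $\rho,p$ are functions (energy density, pressure); $q$ is a $1$-form with $q(X)=q(\mathcal SX)$; $\pi$ is a symmetric tensor field with $\pi(X,Y)=\pi(\mathcal SX,\mathcal SY)$ that is trace-free, $\bar g^{ij}\pi_{ij}=0$; $q_i=q(\delta/\delta x^i)$, $\pi_{ij}=\pi(\delta/\delta x^j,\delta/\delta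 x^i)$.
   Formalization: In the second mixed form the term Φ²(ω^k_{i|k}+c_kω^k_i−2ω_{ik}b^k) is taken with sign + instead of the printed −, which contradicts the first form (e.g. Φ=1, A_2=(x^1)^2, flat spatial metric); the equations are stated on the domain of an arbitrary adapted chart. *)

(* Defs.v *)
From HB Require Import structures.
From mathcomp Require Import all_boot all_order all_algebra.
From mathcomp Require Import all_classical all_reals all_analysis.

Set Implicit Arguments.
Unset Strict Implicit.
Unset Printing Implicit Defensive.

Import Order.TTheory GRing.Theory Num.Theory.
Import numFieldNormedType.Exports.

Local Open Scope classical_set_scope.
Local Open Scope ring_scope.

(* The domain of an adapted chart (x^0, x^1, x^2, x^3) is an open set D of
   'rV[R]_4.  Vector fields are given by their components in the coordinate
   frame.  Fields are total functions on 'rV[R]_4, but only their values on D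
   are ever constrained. *)
Section Calculus.
Context {R : realType}.
Local Notation point := 'rV[R]_4.
Local Notation sfield := (point -> R).
Local Notation vfield := (point -> point).

Definition coord_field (a : 'I_4) : vfield := fun=> delta_mx 0 a.

(* X(f), the derivative of the function f along the vector field X. *)
Definition along (X : vfield) (f : sfield) : sfield := fun x => 'D_(X x) f x.

Definition partial (a : 'I_4) (f : sfield) : sfield := along (coord_field a) f.

(* C^infinity on the open set D: iterated partial derivatives of all orders
   exist and are (Frechet) differentiable, hence continuous, on D. *)
Definition smooth_on (D : set point) (f : sfield) : Prop :=
  forall (s : seq 'I_4) (x : point), D x -> differentiable (foldr partial f s) x.

Definition smooth_mx_on (m n : nat) (D : set point) (F : point -> 'M[R]_(m, n)) :
  Prop := forall i j, smooth_on D (fun x => F x i j).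

Definition covector_eval (q : vfield) (X : vfield) : sfield :=
  fun x => (X x *m (q x)^T) 0 0.

Definition bilin (B : point -> 'M[R]_4) (X Y : vfield) : sfield :=
  fun x => (X x *m B x *m (Y x)^T) 0 0.

Definition lie_bracket (X Y : vfield) : vfield := fun x =>
  \row_c (along X (fun y => Y y 0 c) x - along Y (fun y => X y 0 c) x).

(* nab X (nab Y Z) - nab Y (nab X Z) - nab [X,Y] Z *)
Definition curvature (nab : vfield -> vfield -> vfield) (X Y Z : vfield) :
  vfield :=
  fun x => nab X (nab Y Z) x - nab Y (nab X Z) x - nab (lie_bracket X Y) Z x.

Definition minkowski : 'M[R]_4 :=
  diag_mx (\row_a (if a == 0 then -1 else 1)).

(* Smooth symmetric metric whose matrix is congruent to diag(-1,1,1,1). *)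
Definition lorentzian_on (D : set point) (g : point -> 'M[R]_4) : Prop :=
  smooth_mx_on D g /\
  forall x, D x -> (g x)^T = g x /\
    exists2 P : 'M[R]_4, P \in unitmx & P *m g x *m P^T = minkowski.

End Calculus.

Section LeviCivita.
Context {R : realType} (g : 'rV[R]_4 -> 'M[R]_4).
Local Notation point := 'rV[R]_4.
Local Notation sfield := (point -> R).
Local Notation vfield := (point -> point).

(* Gamma^c_ab *)
Definition christoffel (c a b : 'I_4) : sfield := fun x =>
  2^-1 * \sum_d invmx (g x) c d *
    (partial a (fun y => g y b d) x + partial b (fun y => g y a d) x
     - partial d (fun y => g y a b) x).

Definition nabla (X Y : vfield) : vfield := fun x =>
  \row_c (along X (fun y => Y y 0 c) x
          + \sum_a \sum_b christoffel c a b x * X x 0 a * Y x 0 b).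

(* Ric(X,Y) is the trace of Z |-> R(Z,X)Y. *)
Definition ricci (X Y : vfield) : sfield := fun x =>
  \sum_c curvature nabla (coord_field c) X Y x 0 c.

Definition scalar_curvature : sfield := fun x =>
  \sum_a \sum_b invmx (g x) a b * ricci (coord_field a) (coord_field b) x.

Definition einstein_tensor (X Y : vfield) : sfield := fun x =>
  ricci X Y x - 2^-1 * scalar_curvature x * bilin g X Y x.

End LeviCivita.

Section Threading.
Context {R : realType} (g : 'rV[R]_4 -> 'M[R]_4) (Phi : 'rV[R]_4 -> R).
Local Notation point := 'rV[R]_4.
Local Notation sfield := (point -> R).
Local Notation vfield := (point -> point).
(* families of functions indexed by one or two spatial indices *)
Local Notation tensor1 := ('I_3 -> sfield).
Local Notation tensor2 := ('I_3 -> 'I_3 -> sfield).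

(* The coordinate index 0 is [0 : 'I_4]; the spatial index i : 'I_3 stands for
   the coordinate index [sp i] in {1,2,3}. *)
Definition sp (i : 'I_3) : 'I_4 := lift ord0 i.

Definition xi : vfield := coord_field 0.

(* The projection on the g-orthogonal complement of xi. *)
Definition spatial_proj (X : vfield) : vfield := fun x =>
  X x - (bilin g X xi x / bilin g xi xi x) *: xi x.

Definition A_ : tensor1 := fun i x =>
  - (Phi x ^- 2 * bilin g (coord_field (sp i)) xi x).

(* the vector field delta/delta x^i *)
Definition delta (i : 'I_3) : vfield := fun x =>
  coord_field (sp i) x - A_ i x *: xi x.

Definition omega : tensor2 := fun i j x =>
  2^-1 * (along (delta i) (A_ j) x - along (delta j) (A_ i) x).

Definition a_ : tensor1 := fun i x => - partial 0 (A_ i) x.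

Definition c_ : tensor1 := fun i x => (Phi x)^-1 * along (delta i) Phi x.

Definition b_ : tensor1 := fun i x => a_ i x + c_ i x.

Definition Psi : sfield := fun x => (Phi x)^-1 * partial 0 Phi x.

Definition gbar_mx (x : point) : 'M[R]_3 :=
  \matrix_(i, j) bilin g (delta i) (delta j) x.

Definition gbar : tensor2 := fun i j x => gbar_mx x i j.

Definition gbar_inv : tensor2 := fun i j x => invmx (gbar_mx x) i j.

Definition raise1 (v : tensor1) : tensor1 := fun k x =>
  \sum_h gbar_inv k h x * v h x.

(* T^k_j = gbar^{ki} T_ij: the first index is raised. *)
Definition raise_first (T : tensor2) : tensor2 := fun k j x =>
  \sum_i gbar_inv k i x * T i j x.

Definition raise_both (T : tensor2) : tensor2 := fun h k x =>
  \sum_i \sum_j gbar_inv h i x * gbar_inv k j x * T i j x.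

(* T_hk T^hk *)
Definition sqnorm2 (T : tensor2) : sfield := fun x =>
  \sum_h \sum_k T h k x * raise_both T h k x.

Definition gbar_trace (T : tensor2) : sfield := fun x =>
  \sum_i \sum_j gbar_inv i j x * T i j x.

Definition Theta_ : tensor2 := fun i j x => 2^-1 * partial 0 (gbar i j) x.

Definition Theta : sfield := gbar_trace Theta_.

Definition sigma : tensor2 := fun i j x =>
  Theta_ i j x - 3^-1 * Theta x * gbar i j x.

Definition K_ : tensor2 := fun i j x =>
  Theta_ i j x + Phi x ^+ 2 * omega i j x.

Definition b_sq : sfield := fun x => \sum_k b_ k x * raise1 b_ k x.

(* The Riemannian spatial connection, applied to sections Y of SM. *)
Definition nabla_bar (X Y : vfield) : vfield := spatial_proj (nabla g X Y).

(* [Gamma_bar i k j] is the coefficient with lower indices i, j (in this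
   order) and upper index k. *)
Definition Gamma_bar (i k j : 'I_3) : sfield := fun x =>
  2^-1 * \sum_h gbar_inv k h x *
    (along (delta i) (gbar h j) x + along (delta j) (gbar h i) x
     - along (delta h) (gbar i j) x).

(* The covariant derivatives denoted by a vertical bar. *)

(* w_{i|j} *)
Definition cov_low (w : tensor1) (i j : 'I_3) : sfield := fun x =>
  along (delta j) (w i) x - \sum_h w h x * Gamma_bar i h j x.

(* v^i_{|j} *)
Definition cov_up (v : tensor1) (i j : 'I_3) : sfield := fun x =>
  along (delta j) (v i) x + \sum_h v h x * Gamma_bar h i j x.

(* T^j_{i|k}, where [T j i] is T^j_i *)
Definition cov_mixed (T : tensor2) (j i k : 'I_3) : sfield := fun x =>
  along (delta k) (T j i) x + \sum_h T h i x * Gamma_bar h j k x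
  - \sum_h T j h x * Gamma_bar i h k x.

(* T_{ij|0} *)
Definition cov0_low2 (T : tensor2) (i j : 'I_3) : sfield := fun x =>
  partial 0 (T i j) x - \sum_h T h j x * raise_first K_ h i x
  - \sum_h T i h x * raise_first K_ h j x.

Definition curvature_bar (X Y Z : vfield) : vfield :=
  curvature nabla_bar X Y (spatial_proj Z).

(* Since delta_h = d_h - A_h d_0, the component of a spatial vector along
   delta_h is its coordinate component of index [sp h]. *)

(* [Rbar i h j k] is R_i^h_jk: the delta_h component of
   R(delta_k, delta_j) delta_i. *)
Definition Rbar (i h j k : 'I_3) : sfield := fun x =>
  curvature_bar (delta k) (delta j) (delta i) x 0 (sp h).

(* [Rbar0 i h k] is R_i^h_0k: the delta_h component of
   R(delta_k, d_0) delta_i. *)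
Definition Rbar0 (i h k : 'I_3) : sfield := fun x =>
  curvature_bar (delta k) xi (delta i) x 0 (sp h).

Definition ricci_bar : tensor2 := fun i j x =>
  2^-1 * (\sum_k Rbar i k j k x + \sum_k Rbar j k i k x).

Definition scalar_bar : sfield := gbar_trace ricci_bar.

Definition einstein_bar : tensor2 := fun i j x =>
  ricci_bar i j x - 2^-1 * scalar_bar x * gbar i j x.

Section Matter.
Context (rho p : sfield) (q : vfield) (pi_ : point -> 'M[R]_4) (Lambda GN : R).

Definition u_form (X : vfield) : sfield := fun x =>
  (Phi x)^-1 * bilin g X xi x.

Definition energy_momentum (X Y : vfield) : sfield := fun x =>
  rho x * u_form X x * u_form Y x
  + covector_eval q X x * u_form Y x + covector_eval q Y x * u_form X x
  + p x * bilin g (spatial_proj X) (spatial_proj Y) x + bilin pi_ X Y x.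

Definition q_ : tensor1 := fun i => covector_eval q (delta i).

Definition pi_comp : tensor2 := fun i j => bilin pi_ (delta j) (delta i).

Definition spatial_oneform (D : set point) : Prop :=
  forall X x, smooth_mx_on D X -> D x ->
    covector_eval q X x = covector_eval q (spatial_proj X) x.

Definition spatial_symmetric_tracefree (D : set point) : Prop :=
  [/\ forall x, D x -> (pi_ x)^T = pi_ x,
      forall X Y x, smooth_mx_on D X -> smooth_mx_on D Y -> D x ->
        bilin pi_ X Y x = bilin pi_ (spatial_proj X) (spatial_proj Y) x
    & forall x, D x -> gbar_trace pi_comp x = 0].

Definition einstein_field_equations (D : set point) : Prop :=
  forall X Y, smooth_mx_on D X -> smooth_mx_on D Y -> forall x, D x ->
    einstein_tensor g X Y x + Lambda * bilin g X Y x
    = 8 * pi * GN * energy_momentum X Y x.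

Definition spatial_equation (i j : 'I_3) (x : point) : Prop :=
  einstein_bar i j x
  + (b_sq x + \sum_k cov_up (raise1 b_) k k x
     + 2^-1 * Phi x ^+ 2 * sqnorm2 omega x + Lambda) * gbar i j x
  - 2^-1 * (cov_low b_ i j x + cov_low b_ j i x) - b_ i x * b_ j x
  + Phi x ^- 2 *
    ((Theta x - Psi x) * Theta_ i j x + cov0_low2 Theta_ i j x
     - (partial 0 Theta x - Psi x * Theta x + 2 / 3 * Theta x ^+ 2
        + 2^-1 * sqnorm2 sigma x) * gbar i j x)
  = 8 * pi * GN * (p x * gbar i j x + pi_comp i j x).

Definition mixed_equation1 (i : 'I_3) (x : point) : Prop :=
  \sum_k Rbar0 i k k x + Theta x * b_ i x
  - \sum_k Theta_ i k x * raise1 b_ k x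
  - Phi x ^+ 2 * \sum_k omega i k x * raise1 b_ k x
  = - (8 * pi * GN * Phi x * q_ i x).

(* In the source the term in omega carries the opposite sign.  With
   omega^k_i = gbar^{kh} omega_hi that sign is incompatible with
   [mixed_equation1]: for g = - (dx^0 + A_2 dx^2)^2 + sum_i (dx^i)^2 with
   A_2 = (x^1)^2, Phi = 1, all of Theta_ij, a_i, c_i and Gamma_bar vanish, and
   R_2^k_0k = K^k_{2|k} = omega^k_{2|k} = 1. *)
Definition mixed_equation2 (i : 'I_3) (x : point) : Prop :=
  \sum_k cov_mixed (raise_first Theta_) k i k x - along (delta i) Theta x
  + Theta x * c_ i x - \sum_k Theta_ i k x * raise1 c_ k x
  + Phi x ^+ 2 *
    (\sum_k cov_mixed (raise_first omega) k i k x
     + \sum_k c_ k x * raise_first omega k i x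
     - 2 * \sum_k omega i k x * raise1 b_ k x)
  = - (8 * pi * GN * Phi x * q_ i x).

Definition temporal_equation (x : point) : Prop :=
  Phi x ^+ 2 * scalar_bar x + 2 / 3 * Theta x ^+ 2 - sqnorm2 sigma x
  + Phi x ^+ 4 * sqnorm2 omega x
  = 2 * Phi x ^+ 2 * (Lambda + 8 * pi * GN * rho x).

End Matter.
End Threading.

(* Main.v *)
Require Import Defs.
From HB Require Import structures.
From mathcomp Require Import all_boot all_order all_algebra.
From mathcomp Require Import all_classical all_reals all_analysis.
From mathcomp Require Import ring lra.

Set Implicit Arguments.
Unset Strict Implicit.
Unset Printing Implicit Defensive.

Import Order.TTheory GRing.Theory Num.Theory.
Import numFieldNormedType.Exports.

Local Open Scope classical_set_scope.
Local Open Scope ring_scope.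

(** Both sides of the field equations are symmetric and bilinear over smooth
    functions ([einstein_bilin], [energy_momentum_lin], [energy_momentum_sym]),
    so they hold for all vector fields as soon as they hold for pairs taken from
    the adapted frame: xi together with the delta_i ([frame_vanish],
    [einstein_field_equations_frame]).  The three kinds of pairs give the three
    groups of equations.  On the matter side the spatial one-form q and the
    spatial tensor pi vanish on xi, so that T(xi,xi), T(xi,delta_i) and
    T(delta_i,delta_j) see only rho, only q, and only p and pi.

    On the geometric side, the adapted frame has the brackets
    [xi, delta_i] = a_i xi and [delta_i, delta_j] = -2 omega_ij xi
    ([bracket_0fr], [bracket_fr]), and xi is orthogonal to every delta_i.
    Vanishing torsion and compatibility with the metric then determine the
    Levi-Civita connection on the frame ([conn_00], [conn_0s], [conn_s0],
    [conn_ss]): its spatial part is the spatial connection, and the remaining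
    coefficients are K, b, c and Psi.  Consequently the spacetime curvature is
    the spatial curvature plus terms built from K and b ([riem_sss],
    [riem_s0s], [riem_s00], [thet_riem_0ss]); taking traces yields the Ricci
    tensor ([ric_0s], [ric_ss], [ric_00]).

    Three further observations lead to the stated form.
    - The Ricci tensor of a Levi-Civita connection is symmetric ([ricC], from
      the first Bianchi identity and the skew-symmetry of the curvature), hence
      only the part of [ric_ss] symmetric in i and j matters.  There K_ij is
      replaced by Theta_ij and the spatial Ricci form by its symmetrization
      ([ric_ss_sym]).
    - The spatial derivatives are metric, so contracting with gbar commutes with
      them ([contract_cov_low], [contract_cov0_expn]).  This computes the scalar
      curvature ([scalE]) and thereby the frame components of the Einstein
      tensor ([ein_spatial], [ein_mixed], [ein_temporal]).  The shear enters
      through Theta_hk Theta^hk = sigma^2 + Theta^2 / 3.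
    - The two mixed equations agree because the trace of the curvature
      components R_i^k_0k is the divergence of K minus the derivative of Theta,
      up to algebraic terms ([mixed_forms]).  Indeed Gamma_i^k_k is half the
      logarithmic derivative of det gbar along delta_i, the derivative along xi
      of half the logarithm of det gbar is Theta, and exchanging the two
      derivatives costs a_i Theta ([d0_trace_Gb]).

    All of this is algebra: the only facts about functions that enter are the
    Leibniz rule, the symmetry of second derivatives and the invertibility of g,
    Phi and 2.  The computation is therefore carried out in a commutative ring
    with four commuting derivations ([spacetime]), where identities are settled
    by normalization.  Smooth functions on the open set D form such a ring
    ([sfun], [model]); what has to be checked analytically is the closure of
    smooth functions under products and inverses ([smooth_uptoM],
    [smooth_uptoV]) and the symmetry of second derivatives ([schwarz]).  The
    relation [repr] carries every geometric quantity to its algebraic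
    counterpart. *)

(** * Differential-algebraic model of a threaded spacetime *)

(** Exactly what the curvature computation uses: the derivations [pd] stand for the
    coordinate derivatives, [lapse] for Phi with inverse [lapseI], and [metric00]
    says g(xi, xi) = - Phi^2.  Inverses are data, since the ring need not be a
    field. *)
Record spacetime (A : comPzRingType) := Spacetime {
  pd : 'I_4 -> A -> A;
  pdD : forall a f g, pd a (f + g) = pd a f + pd a g;
  pdM : forall a f g, pd a (f * g) = pd a f * g + f * pd a g;
  pdC : forall a b f, pd a (pd b f) = pd b (pd a f);
  metric : 'M[A]_4;
  cometric : 'M[A]_4;
  metricT : metric^T = metric;
  metricK : metric *m cometric = 1%:M;
  lapse : A;
  lapseI : A;
  lapseK : lapse * lapseI = 1;
  metric00 : metric 0 0 = - lapse ^+ 2;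
  half : A;
  halfK : 2 * half = 1
}.

Section Algebra.
Context {A : comPzRingType} (S : spacetime A).
Local Notation G := (metric S).
Local Notation GI := (cometric S).
Local Notation N := (lapse S).
Local Notation NI := (lapseI S).
Local Notation h := (half S).
Local Notation vect := 'rV[A]_4.
Implicit Types (f : A) (X Y Z W : vect).

Lemma halfD f : h * f + h * f = f.
Proof. ring: (halfK S). Qed.

Lemma half_eq f f' : f + f = f' + f' -> f = f'.
Proof. by move=> e; rewrite -[f]halfD -[f']halfD -!mulrDr e. Qed.

Lemma addmxE m n (M L : 'M[A]_(m, n)) i j : (M + L) i j = M i j + L i j.
Proof. by rewrite mxE. Qed.

Lemma oppmxE m n (M : 'M[A]_(m, n)) i j : (- M) i j = - M i j.
Proof. by rewrite mxE. Qed.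

Lemma scalemxE m n f (M : 'M[A]_(m, n)) i j : (f *: M) i j = f * M i j.
Proof. by rewrite mxE. Qed.

(** * Derivatives along vector fields *)

(** The geometric quantities below are locked, each with an unfolding equation:
    they then remain atoms for normalization and for the comparison of sums. *)
Definition dirder : vect -> A -> A := locked (fun X f => \sum_a X 0 a * pd S a f).

Lemma dirderE X f : dirder X f = \sum_a X 0 a * pd S a f.
Proof. by rewrite /dirder -lock. Qed.

Lemma dirderD X f f' : dirder X (f + f') = dirder X f + dirder X f'.
Proof.
by rewrite !dirderE -big_split; apply: eq_bigr => a _; rewrite pdD mulrDr.
Qed.

Lemma dirderM X f f' : dirder X (f * f') = dirder X f * f' + f * dirder X f'.
Proof.
rewrite !dirderE mulr_suml mulr_sumr -big_split; apply: eq_bigr => a _ /=.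
rewrite pdM; ring.
Qed.

Lemma dirder0 X : dirder X 0 = 0.
Proof. by apply: (addrI (dirder X 0)); rewrite -dirderD !addr0. Qed.

Lemma dirderN X f : dirder X (- f) = - dirder X f.
Proof. by apply: (addrI (dirder X f)); rewrite -dirderD !addrN dirder0. Qed.

Lemma dirder_sum X (I : finType) (F : I -> A) :
  dirder X (\sum_i F i) = \sum_i dirder X (F i).
Proof. by apply: (big_morph (dirder X) (@dirderD X)); rewrite dirder0. Qed.

Lemma dirder1 X : dirder X 1 = 0.
Proof.
apply: (addrI (dirder X 1)).
by rewrite addr0 -[in RHS](mulr1 1) dirderM !mulr1 mul1r.
Qed.

Lemma dirder_half X : dirder X h = 0.
Proof.
apply: half_eq; rewrite addr0 -dirderD -mulr2n -mulr_natl halfK dirder1.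
by [].
Qed.

Lemma dirderI X : dirder X NI = - NI ^+ 2 * dirder X N.
Proof.
have e : N * dirder X NI = - (dirder X N * NI).
  by apply/eqP; rewrite -addr_eq0 addrC -dirderM lapseK dirder1.
by rewrite -[LHS]mul1r -(lapseK S) mulrAC e; ring.
Qed.

Lemma dirderDl X Y f : dirder (X + Y) f = dirder X f + dirder Y f.
Proof.
by rewrite !dirderE -big_split; apply: eq_bigr => a _; rewrite mxE mulrDl.
Qed.

Lemma dirderZl k X f : dirder (k *: X) f = k * dirder X f.
Proof. by rewrite !dirderE mulr_sumr; apply: eq_bigr => a _; rewrite mxE mulrA. Qed.

Definition ecoord : 'I_4 -> vect := locked (fun a => delta_mx 0 a).

Lemma ecoordE a b : ecoord a 0 b = (b == a)%:R.
Proof. by rewrite /ecoord -lock mxE. Qed.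

Lemma row_sum_ecoord X : X = \sum_a X 0 a *: ecoord a.
Proof. by rewrite {1}[X]row_sum_delta; under [RHS]eq_bigr do rewrite /ecoord -lock. Qed.

Lemma dirder_coord a f : dirder (ecoord a) f = pd S a f.
Proof.
rewrite !dirderE (bigD1 a) //= big1 ?addr0 => [|b ba]; rewrite ecoordE.
  by rewrite eqxx mul1r.
by rewrite (negPf ba) mul0r.
Qed.

Definition bracket : vect -> vect -> vect :=
  locked (fun X Y => \row_c (dirder X (Y 0 c) - dirder Y (X 0 c))).

Lemma bracketE X Y c : bracket X Y 0 c = dirder X (Y 0 c) - dirder Y (X 0 c).
Proof. by rewrite /bracket -lock mxE. Qed.

(** The second-order terms are symmetric in the two slots because the partial
    derivatives commute, so they cancel. *)
Lemma dirder_bracket X Y f :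
  dirder (bracket X Y) f = dirder X (dirder Y f) - dirder Y (dirder X f).
Proof.
have e U V : dirder U (dirder V f) =
    \sum_a dirder U (V 0 a) * pd S a f + \sum_a \sum_b U 0 b * V 0 a * pd S b (pd S a f).
  rewrite [dirder V f]dirderE dirder_sum -big_split; apply: eq_bigr => a _ /=.
  rewrite dirderM; congr (_ + _); rewrite dirderE mulr_sumr; apply: eq_bigr => b _.
  by ring.
rewrite !{}e opprD addrACA [X in _ = _ + X](_ : _ = 0) ?addr0.
  by rewrite [LHS]dirderE -sumrB; apply: eq_bigr => a _; rewrite bracketE mulrBl.
apply/eqP; rewrite subr_eq0; apply/eqP; rewrite exchange_big.
by do 2![apply: eq_bigr => ? _]; rewrite pdC [X 0 _ * _]mulrC.
Qed.

Lemma bracketNC X Y : bracket X Y = - bracket Y X.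
Proof. by apply/rowP => c; rewrite oppmxE !bracketE opprB. Qed.

Lemma bracketDl X X' Y : bracket (X + X') Y = bracket X Y + bracket X' Y.
Proof. by apply/rowP => c; rewrite addmxE !bracketE dirderDl addmxE dirderD; ring. Qed.

Lemma bracketZl f X Y : bracket (f *: X) Y = f *: bracket X Y - dirder Y f *: X.
Proof.
apply/rowP => c.
by rewrite addmxE oppmxE !scalemxE !bracketE dirderZl scalemxE dirderM; ring.
Qed.

(** * The Levi-Civita connection *)

Definition gg : vect -> vect -> A := locked (fun X Y => (X *m G *m Y^T) 0 0).

Lemma ggE X Y : gg X Y = (X *m G *m Y^T) 0 0.
Proof. by rewrite /gg -lock. Qed.

Lemma ggC X Y : gg X Y = gg Y X.
Proof.
rewrite !ggE; transitivity ((X *m G *m Y^T)^T 0 0); first by rewrite [RHS]mxE.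
by rewrite !trmx_mul trmxK metricT mulmxA.
Qed.

Lemma ggDl X Y Z : gg (X + Y) Z = gg X Z + gg Y Z.
Proof. by rewrite !ggE !mulmxDl mxE. Qed.

Lemma ggZl f X Z : gg (f *: X) Z = f * gg X Z.
Proof. by rewrite !ggE -!scalemxAl mxE. Qed.

Lemma ggDr X Y Z : gg Z (X + Y) = gg Z X + gg Z Y.
Proof. by rewrite !(ggC Z) ggDl. Qed.

Lemma ggZr f X Z : gg Z (f *: X) = f * gg Z X.
Proof. by rewrite !(ggC Z) ggZl. Qed.

Lemma ggNl X Z : gg (- X) Z = - gg X Z.
Proof. by rewrite -scaleN1r ggZl mulN1r. Qed.

Lemma ggNr X Z : gg Z (- X) = - gg Z X.
Proof. by rewrite !(ggC Z) ggNl. Qed.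

Lemma ggBl X Y Z : gg (X - Y) Z = gg X Z - gg Y Z.
Proof. by rewrite ggDl ggNl. Qed.

Lemma ggBr X Y Z : gg Z (X - Y) = gg Z X - gg Z Y.
Proof. by rewrite ggDr ggNr. Qed.

Lemma gg_suml (I : finType) (F : I -> vect) Z : gg (\sum_i F i) Z = \sum_i gg (F i) Z.
Proof.
apply: (big_morph (gg^~ Z)) => [X Y|]; first exact: ggDl.
by rewrite -[0](scale0r 0) ggZl mul0r.
Qed.

Lemma gg_coord a b : gg (ecoord a) (ecoord b) = G a b.
Proof. by rewrite ggE /ecoord -!lock -rowE trmx_delta -colE !mxE. Qed.

Lemma cometricT : GI^T = GI.
Proof.
have e : GI^T *m G = 1%:M by rewrite -[in LHS]metricT -trmx_mul metricK trmx1.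
by rewrite -[GI^T]mulmx1 -(metricK S) mulmxA e mul1mx.
Qed.

Lemma cometricK : GI *m G = 1%:M.
Proof. by rewrite -cometricT -[in LHS]metricT -trmx_mul metricK trmx1. Qed.

(** [christoffel_low a b d] is the symbol of the first kind with upper slot d. *)
Definition christoffel_low a : 'M[A]_4 := \matrix_(b, d)
  (h * (pd S a (G b d) + pd S b (G a d) - pd S d (G a b))).

Definition christoffel_mx a : 'M[A]_4 := christoffel_low a *m GI.

(** The covariant derivative along the coordinate field of index [a]. *)
Definition conn_coord a Y : vect := map_mx (pd S a) Y + Y *m christoffel_mx a.

Definition conn : vect -> vect -> vect :=
  locked (fun X Y => \sum_a X 0 a *: conn_coord a Y).

Lemma conn_sumE X Y : conn X Y = \sum_a X 0 a *: conn_coord a Y.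
Proof. by rewrite /conn -lock. Qed.

Lemma connE X Y c : conn X Y 0 c =
  dirder X (Y 0 c) + \sum_a X 0 a * \sum_b Y 0 b * christoffel_mx a b c.
Proof.
rewrite conn_sumE dirderE summxE -big_split; apply: eq_bigr => a _ /=.
by rewrite !mxE mulrDr.
Qed.

Lemma connDl X X' Y : conn (X + X') Y = conn X Y + conn X' Y.
Proof. by rewrite !conn_sumE -big_split; apply: eq_bigr => a _; rewrite mxE scalerDl. Qed.

Lemma connZl f X Y : conn (f *: X) Y = f *: conn X Y.
Proof. by rewrite !conn_sumE scaler_sumr; apply: eq_bigr => a _; rewrite mxE scalerA. Qed.

Lemma connDr X Y Y' : conn X (Y + Y') = conn X Y + conn X Y'.
Proof.
rewrite !conn_sumE -big_split; apply: eq_bigr => a _ /=.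
rewrite -scalerDr; congr (_ *: _); rewrite /conn_coord mulmxDl addrACA.
by congr (_ + _); apply/rowP => c; rewrite !mxE pdD.
Qed.

Lemma connZr f X Y : conn X (f *: Y) = dirder X f *: Y + f *: conn X Y.
Proof.
rewrite !conn_sumE !dirderE scaler_suml scaler_sumr -big_split; apply: eq_bigr => a _ /=.
rewrite (_ : conn_coord a (f *: Y) = pd S a f *: Y + f *: conn_coord a Y).
  by rewrite scalerDr !scalerA [f * _]mulrC.
rewrite /conn_coord scalerDr addrA scalemxAl; congr (_ + _).
by apply/rowP => c; rewrite !mxE pdM.
Qed.

Lemma connNl X Y : conn (- X) Y = - conn X Y.
Proof. by rewrite -!scaleN1r connZl. Qed.

Lemma connBl X X' Y : conn (X - X') Y = conn X Y - conn X' Y.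
Proof. by rewrite connDl connNl. Qed.

Lemma conn0l X : conn 0 X = 0.
Proof. by have := connZl 0 0 X; rewrite !scale0r. Qed.

Lemma conn0r X : conn X 0 = 0.
Proof. by apply: (addrI (conn X 0)); rewrite -connDr !addr0. Qed.

Lemma conn_sumr X (I : finType) (F : I -> vect) :
  conn X (\sum_i F i) = \sum_i conn X (F i).
Proof. by apply: (big_morph (conn X)); [exact: connDr | exact: conn0r]. Qed.

Lemma metric_sym a b : G a b = G b a.
Proof. by rewrite -{1}(metricT S) mxE. Qed.

Lemma cometric_sym a b : GI a b = GI b a.
Proof. by rewrite -{1}cometricT mxE. Qed.

(** The Christoffel symbols are symmetric in their two lower indices, so only the
    derivatives of the components survive in the difference. *)
Lemma conn_torsion X Y : conn X Y - conn Y X = bracket X Y.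
Proof.
apply/rowP => c; rewrite addmxE oppmxE bracketE !connE opprD addrACA -[RHS]addr0; congr (_ + _).
apply/eqP; rewrite subr_eq0; apply/eqP.
under eq_bigr do rewrite mulr_sumr; under [RHS]eq_bigr do rewrite mulr_sumr.
rewrite exchange_big /=; apply: eq_bigr => b _; apply: eq_bigr => a _.
rewrite mulrCA; do 2!congr (_ * _); rewrite !mxE; apply: eq_bigr => d _.
by rewrite !mxE (metric_sym a b); congr (_ * _); ring.
Qed.

(** Metric compatibility in coordinates: two Christoffel symbols of the first kind
    that differ by the exchange of b and d add up to the derivative of g_bd. *)
Lemma pd_metric a : map_mx (pd S a) G = christoffel_mx a *m G + G *m (christoffel_mx a)^T.
Proof.
rewrite /christoffel_mx trmx_mul mulmxA cometricT (metricK S) mul1mx -mulmxA cometricK mulmx1.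
apply/matrixP => b d; rewrite !mxE (metric_sym d b) (metric_sym a d) (metric_sym a b).
ring: (halfK S).
Qed.

Lemma pd_sum a (I : finType) (F : I -> A) : pd S a (\sum_i F i) = \sum_i pd S a (F i).
Proof. by rewrite -dirder_coord dirder_sum; apply: eq_bigr => i _; rewrite dirder_coord. Qed.

Lemma pd_mulmx a m n p (M : 'M[A]_(m, n)) (L : 'M[A]_(n, p)) :
  map_mx (pd S a) (M *m L) = map_mx (pd S a) M *m L + M *m map_mx (pd S a) L.
Proof.
apply/matrixP => i j; rewrite !mxE pd_sum -big_split; apply: eq_bigr => k _ /=.
by rewrite !mxE pdM.
Qed.

Lemma conn_metric X Y Z : dirder X (gg Y Z) = gg (conn X Y) Z + gg Y (conn X Z).
Proof.
rewrite (ggC Y (conn X Z)) !conn_sumE !dirderE !gg_suml -big_split; apply: eq_bigr => a _ /=.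
rewrite !ggZl -mulrDr; congr (_ * _); rewrite (ggC _ Y) !ggE.
have -> : pd S a ((Y *m G *m Z^T) 0 0) = (map_mx (pd S a) (Y *m G *m Z^T)) 0 0 by rewrite [RHS]mxE.
rewrite !pd_mulmx pd_metric /conn_coord [(_ + Z *m _)^T]linearD /=.
rewrite [(Z *m _)^T]trmx_mul matrix.map_trmx.
by rewrite !(mulmxDl, mulmxDr) !mulmxA !addmxE; ring.
Qed.

(** * Curvature *)

Definition riem : vect -> vect -> vect -> vect := locked (fun X Y Z =>
  conn X (conn Y Z) - conn Y (conn X Z) - conn (bracket X Y) Z).

Lemma riemE X Y Z :
  riem X Y Z = conn X (conn Y Z) - conn Y (conn X Z) - conn (bracket X Y) Z.
Proof. by rewrite /riem -lock. Qed.

Lemma riemNC X Y Z : riem X Y Z = - riem Y X Z.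
Proof.
rewrite !riemE (bracketNC X Y) connNl !opprD !opprK.
by rewrite [in RHS]addrAC addrC addrA addrAC.
Qed.

Lemma riemDl X X' Y Z : riem (X + X') Y Z = riem X Y Z + riem X' Y Z.
Proof.
rewrite !riemE bracketDl !connDl connDr.
by apply/rowP => c; rewrite !mxE; ring.
Qed.

(** Tensoriality: the derivative of f produced by the bracket cancels the one
    produced by the second covariant derivative. *)
Lemma riemZl f X Y Z : riem (f *: X) Y Z = f *: riem X Y Z.
Proof.
rewrite !riemE bracketZl connBl !connZl connZr.
by apply/rowP => c; rewrite !mxE; ring.
Qed.

Lemma riemDm X Y Y' Z : riem X (Y + Y') Z = riem X Y Z + riem X Y' Z.
Proof. by rewrite !(riemNC X) riemDl opprD. Qed.

Lemma riemZm f X Y Z : riem X (f *: Y) Z = f *: riem X Y Z.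
Proof. by rewrite !(riemNC X) riemZl scalerN. Qed.

Lemma riemDr X Y Z Z' : riem X Y (Z + Z') = riem X Y Z + riem X Y Z'.
Proof.
by rewrite !riemE !connDr; apply/rowP => c; rewrite !mxE; ring.
Qed.

(** The first derivatives of f appear symmetrically in X and Y and cancel; the second
    ones are absorbed by the derivative along the bracket. *)
Lemma riemZr f X Y Z : riem X Y (f *: Z) = f *: riem X Y Z.
Proof.
rewrite !riemE !connZr !connDr !connZr dirder_bracket.
by apply/rowP => c; rewrite !mxE; ring.
Qed.

(** Both sides of [dirder_bracket] applied to the function g(Z, W), expanded with
    [conn_metric]: the mixed first-derivative terms cancel. *)
Lemma riem_skew X Y Z W : gg (riem X Y Z) W + gg Z (riem X Y W) = 0.
Proof.
have e U V : dirder U (dirder V (gg Z W)) =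
    gg (conn U (conn V Z)) W + gg (conn V Z) (conn U W)
    + (gg (conn U Z) (conn V W) + gg Z (conn U (conn V W))).
  by rewrite conn_metric dirderD !conn_metric.
have := conn_metric (bracket X Y) Z W.
rewrite dirder_bracket !e !riemE !(ggBl, ggDr, ggNr) => /eqP.
by rewrite -subr_eq0 => /eqP <-; ring.
Qed.

(** A skew form contracted with the symmetric cometric vanishes.  Together with the
    first Bianchi identity this makes the Ricci tensor symmetric. *)
Lemma trace_riem X Y : \sum_c riem X Y (ecoord c) 0 c = 0.
Proof.
(* M is the endomorphism R(X, Y); lowering its index gives a skew form. *)
pose M : 'M[A]_4 := \matrix_c riem X Y (ecoord c).
have MG a b : (M *m G) a b = gg (riem X Y (ecoord a)) (ecoord b).
  rewrite ggE [ecoord b]/ecoord -lock trmx_delta -colE [RHS]mxE [LHS]mxE [RHS]mxE.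
  by apply: eq_bigr => c _; rewrite mxE.
have skew a b : (M *m G) a b = - (M *m G) b a.
  apply/eqP; rewrite -addr_eq0 !MG [gg _ (ecoord a)]ggC.
  by rewrite riem_skew.
have -> : \sum_c riem X Y (ecoord c) 0 c = \sum_a \sum_b (M *m G) a b * GI b a.
  transitivity (\tr (M *m G *m GI)); last first.
    by apply: eq_bigr => a _; rewrite mxE; apply: eq_bigr.
  by rewrite -mulmxA (metricK S) mulmx1; apply: eq_bigr => c _; rewrite [RHS]mxE.
apply: half_eq; rewrite addr0 {2}exchange_big -big_split big1 //= => b _.
rewrite -big_split big1 //= => a _.
by rewrite (skew a b) (cometric_sym a b) mulNr addrN.
Qed.

(** On coordinate fields the brackets vanish and the torsion-free connection is
    symmetric, so the six second covariant derivatives cancel in pairs. *)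
Lemma riem_bianchi a b c :
  riem (ecoord a) (ecoord b) (ecoord c) + riem (ecoord b) (ecoord c) (ecoord a)
  + riem (ecoord c) (ecoord a) (ecoord b) = 0.
Proof.
have br0 i j : bracket (ecoord i) (ecoord j) = 0.
  have d0 X k l : dirder X (ecoord k 0 l) = 0.
    by rewrite ecoordE; case: eqP => _; rewrite (dirder0, dirder1).
  by apply/rowP => l; rewrite bracketE !d0 subrr mxE.
have tor i j : conn (ecoord i) (ecoord j) = conn (ecoord j) (ecoord i).
  by apply/eqP; rewrite -subr_eq0 conn_torsion br0.
rewrite !riemE !br0 !conn0l (tor c a) (tor c b) (tor b a).
move: (conn _ (conn _ (ecoord c))) (conn (ecoord b) _) (conn (ecoord c) _) => P Q R'.
by rewrite !subr0 !addrA !subrK subrr.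
Qed.

(** * Ricci tensor *)

Definition ric : vect -> vect -> A :=
  locked (fun X Y => \sum_c riem (ecoord c) X Y 0 c).

Lemma ricE X Y : ric X Y = \sum_c riem (ecoord c) X Y 0 c.
Proof. by rewrite /ric -lock. Qed.

Lemma ricDl X X' Y : ric (X + X') Y = ric X Y + ric X' Y.
Proof. by rewrite !ricE -big_split; apply: eq_bigr => c _; rewrite riemDm mxE. Qed.

Lemma ricZl f X Y : ric (f *: X) Y = f * ric X Y.
Proof. by rewrite !ricE mulr_sumr; apply: eq_bigr => c _; rewrite riemZm mxE. Qed.

Lemma ricDr X Y Y' : ric X (Y + Y') = ric X Y + ric X Y'.
Proof. by rewrite !ricE -big_split; apply: eq_bigr => c _; rewrite riemDr mxE. Qed.

Lemma ricZr f X Y : ric X (f *: Y) = f * ric X Y.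
Proof. by rewrite !ricE mulr_sumr; apply: eq_bigr => c _; rewrite riemZr mxE. Qed.

Lemma ric_expand X Y :
  ric X Y = \sum_a \sum_b X 0 a * Y 0 b * ric (ecoord a) (ecoord b).
Proof.
have ric0l Z : ric 0 Z = 0 by have := ricZl 0 0 Z; rewrite scale0r mul0r.
have ric0r Z : ric Z 0 = 0 by have := ricZr 0 Z 0; rewrite scale0r mul0r.
rewrite {1}(row_sum_ecoord X) (big_morph (ric^~ Y) (fun X X' => ricDl X X' Y) (ric0l Y)).
apply: eq_bigr => a _; rewrite ricZl.
rewrite {1}(row_sum_ecoord Y) (big_morph _ (ricDr (ecoord a)) (ric0r _)) mulr_sumr.
by apply: eq_bigr => b _; rewrite ricZr mulrA.
Qed.

(** The trace over c of the Bianchi identity for c, a, b leaves Ric_ab - Ric_ba and the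
    trace of R(a, b), which is zero. *)
Lemma ricC X Y : ric X Y = ric Y X.
Proof.
rewrite ric_expand [RHS]ric_expand exchange_big /=.
apply: eq_bigr => b _; apply: eq_bigr => a _; rewrite [X 0 _ * _]mulrC; congr (_ * _).
apply/eqP; rewrite -subr_eq0 -oppr_eq0 -(trace_riem (ecoord a) (ecoord b)).
apply/eqP; rewrite opprB !ricE -sumrB; apply: eq_bigr => c _.
have := congr1 (fun V : vect => V 0 c) (riem_bianchi c a b).
have zeroE : (0 : vect) 0 c = 0 by rewrite mxE.
rewrite (riemNC (ecoord b) (ecoord c) (ecoord a)) !addmxE oppmxE zeroE.
move: (riem (ecoord c) (ecoord a) (ecoord b) 0 c) (riem (ecoord a) (ecoord b) (ecoord c) 0 c).
move: (riem (ecoord c) (ecoord b) (ecoord a) 0 c).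
by move=> P Q R' /eqP; rewrite subr_eq0 => /eqP <-; rewrite [Q + _]addrC addrK.
Qed.

(** * The adapted frame *)

Local Notation e0 := (ecoord 0).
Local Notation es := sp.
Local Notation d0 := (dirder e0).

(** The components A_i; then [fr i] is delta_i, the part of the coordinate field
    orthogonal to xi. *)
Definition slope : 'I_3 -> A := locked (fun i => - (NI ^+ 2 * G (es i) 0)).

Lemma slopeE i : slope i = - (NI ^+ 2 * G (es i) 0).
Proof. by rewrite /slope -lock. Qed.

Definition fr : 'I_3 -> vect := locked (fun i => ecoord (es i) - slope i *: e0).

Lemma frE i : fr i = ecoord (es i) - slope i *: e0.
Proof. by rewrite /fr -lock. Qed.

Local Notation di i := (dirder (fr i)).

(** In order: omega_ij, a_i, c_i, b_i, Psi, gbar_ij, gbar^ij, Theta_ij, K_ij, the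
    raising of the first index, and the coefficients Gamma_i^k_j of the spatial
    connection.  The inverse of gbar is the spatial block of the cometric; see
    [gbK]. *)
Definition vort := locked (fun i j => h * (di i (slope j) - di j (slope i))).
Definition acc_a := locked (fun i => - d0 (slope i)).
Definition acc_c := locked (fun i => NI * di i N).
Definition acc_b := locked (fun i => acc_a i + acc_c i).
Definition psi := locked (NI * d0 N).
Definition gb := locked (fun i j => gg (fr i) (fr j)).
Definition gbi := locked (fun k j : 'I_3 => GI (es k) (es j)).
Definition expn := locked (fun i j => h * d0 (gb i j)).
Definition Kl := locked (fun i j => expn i j + N ^+ 2 * vort i j).
Definition up1 (w : 'I_3 -> A) k := \sum_i gbi k i * w i.
Definition up (T : 'I_3 -> 'I_3 -> A) k j := \sum_i gbi k i * T i j.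
Definition Gb := locked (fun i k j =>
  h * \sum_l gbi k l * (di i (gb l j) + di j (gb l i) - di l (gb i j))).

Lemma vortE i j : vort i j = h * (di i (slope j) - di j (slope i)).
Proof. by rewrite /vort -lock. Qed.

Lemma acc_aE i : acc_a i = - d0 (slope i).
Proof. by rewrite /acc_a -lock. Qed.

Lemma acc_cE i : acc_c i = NI * di i N.
Proof. by rewrite /acc_c -lock. Qed.

Lemma acc_bE i : acc_b i = acc_a i + acc_c i.
Proof. by rewrite /acc_b -lock. Qed.

Lemma psiE : psi = NI * d0 N.
Proof. by rewrite /psi -lock. Qed.

Lemma gbiE k j : gbi k j = GI (es k) (es j).
Proof. by rewrite /gbi -lock. Qed.

Lemma expnE i j : expn i j = h * d0 (gb i j).
Proof. by rewrite /expn -lock. Qed.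

Lemma KlE i j : Kl i j = expn i j + N ^+ 2 * vort i j.
Proof. by rewrite /Kl -lock. Qed.

Lemma GbE i k j : Gb i k j =
  h * \sum_l gbi k l * (di i (gb l j) + di j (gb l i) - di l (gb i j)).
Proof. by rewrite /Gb -lock. Qed.

Lemma gbE i j : gb i j = gg (fr i) (fr j).
Proof. by rewrite /gb -lock. Qed.

Lemma gbC i j : gb i j = gb j i.
Proof. by rewrite !gbE ggC. Qed.

Lemma gbiC i j : gbi i j = gbi j i.
Proof. by rewrite !gbiE; exact: cometric_sym. Qed.

Lemma fr0 i : fr i 0 0 = - slope i.
Proof. by rewrite frE addmxE oppmxE scalemxE !ecoordE mulr1 add0r. Qed.

Lemma frS i j : fr i 0 (es j) = (j == i)%:R.
Proof.
by rewrite frE addmxE oppmxE scalemxE !ecoordE (inj_eq lift_inj) mulr0 subr0.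
Qed.

Lemma sum_es (F : 'I_4 -> A) : \sum_a F a = F 0 + \sum_i F (es i).
Proof. exact: big_ord_recl. Qed.

Lemma sum_kron (F : 'I_3 -> A) i : \sum_j F j * (j == i)%:R = F i.
Proof.
rewrite (bigD1 i) //= eqxx mulr1 big1 ?addr0 // => j /negPf ->.
by rewrite mulr0.
Qed.

Lemma row_eq X Y :
  X 0 0 = Y 0 0 -> (forall i, X 0 (es i) = Y 0 (es i)) -> X = Y.
Proof.
move=> e eS; apply/rowP => a; have [i|] := unliftP 0 a; last by move->.
by move->; exact: eS.
Qed.

Lemma gg00 : gg e0 e0 = - N ^+ 2.
Proof. by rewrite gg_coord metric00. Qed.

Lemma gg_fr0 i : gg (fr i) e0 = 0.
Proof.
by rewrite frE ggBl ggZl !gg_coord metric00 slopeE; ring: (lapseK S).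
Qed.

Lemma gg_0fr i : gg e0 (fr i) = 0.
Proof. by rewrite ggC gg_fr0. Qed.

Lemma dirder_ecoord0 b X : dirder X (b%:R) = 0.
Proof. by elim: b => [|b IH]; rewrite ?dirder0 // -natr1 dirderD IH dirder1 addr0. Qed.

Lemma bracket_0fr i : bracket e0 (fr i) = acc_a i *: e0.
Proof.
apply: row_eq => [|j]; rewrite bracketE scalemxE !ecoordE !dirder_ecoord0 subr0.
  by rewrite fr0 dirderN mulr1 acc_aE.
by rewrite frS dirder_ecoord0 mulr0.
Qed.

Lemma vort_anti i j : vort i j = - vort j i.
Proof. by rewrite !vortE; ring. Qed.

Lemma bracket_fr i j : bracket (fr i) (fr j) = - (vort i j + vort i j) *: e0.
Proof.
apply: row_eq => [|k]; rewrite bracketE scalemxE ecoordE.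
  by rewrite mulr1 vortE halfD !fr0 !dirderN; ring.
by rewrite !frS !dirder_ecoord0 mulr0 subr0.
Qed.

(** Vectors in frame components: the coefficient of xi and those of the fr_l. *)
Definition vec : A -> ('I_3 -> A) -> vect :=
  locked (fun f v => f *: e0 + \sum_l v l *: fr l).

Lemma vecE f v : vec f v = f *: e0 + \sum_l v l *: fr l.
Proof. by rewrite /vec -lock. Qed.

Lemma eq_vec f f' v v' : f = f' -> v =1 v' -> vec f v = vec f' v'.
Proof.
by move=> -> e; rewrite !vecE; under eq_bigr do rewrite e.
Qed.

Lemma vec0 f v : vec f v 0 0 = f - \sum_l v l * slope l.
Proof.
rewrite vecE addmxE scalemxE ecoordE mulr1 summxE -sumrN; congr (_ + _).
by apply: eq_bigr => l _; rewrite scalemxE fr0 mulrN.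
Qed.

Lemma vecS f v k : vec f v 0 (es k) = v k.
Proof.
rewrite vecE addmxE scalemxE ecoordE mulr0 add0r summxE.
by under eq_bigr do rewrite scalemxE frS eq_sym; rewrite sum_kron.
Qed.

(** The one-form dual to xi in the adapted frame, dx^0 + A_k dx^k.  The other dual
    forms are the coordinate forms dx^k, since fr_k = d_k - A_k xi. *)
Definition thet X := X 0 0 + \sum_k X 0 (es k) * slope k.

Lemma vecK X : X = vec (thet X) (fun k => X 0 (es k)).
Proof. by apply: row_eq => [|k]; rewrite ?vec0 ?vecS // addrK. Qed.

Lemma gg_vec0 f v : gg (vec f v) e0 = - N ^+ 2 * f.
Proof.
rewrite vecE ggDl ggZl gg00 gg_suml big1 ?addr0 1?mulrC // => l _.
by rewrite ggZl gg_fr0 mulr0.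
Qed.

Lemma gg_vec_fr f v j : gg (vec f v) (fr j) = \sum_k v k * gb k j.
Proof.
rewrite vecE ggDl ggZl gg_0fr mulr0 add0r gg_suml; apply: eq_bigr => k _.
by rewrite ggZl gbE.
Qed.

(** Contract fr_i with g and then with the cometric: the term of index 0 drops out
    because fr_i is orthogonal to xi, and g(fr_i, d_j) = g(fr_i, fr_j) for the same
    reason. *)
Lemma gbK i k : \sum_j gb i j * gbi j k = (k == i)%:R.
Proof.
rewrite -frS.
have -> : fr i 0 (es k) = \sum_b gg (fr i) (ecoord b) * GI b (es k).
  transitivity ((fr i *m G *m GI) 0 (es k)); first by rewrite -mulmxA metricK mulmx1.
  rewrite [LHS]mxE; apply: eq_bigr => b _.
  by rewrite ggE /ecoord -lock trmx_delta -colE [in RHS]mxE.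
rewrite sum_es gg_fr0 mul0r add0r; apply: eq_bigr => j _; rewrite gbE gbiE.
by rewrite [X in gg _ X]frE ggDr ggNr ggZr gg_fr0 mulr0 subr0.
Qed.

Lemma gbiK i k : \sum_j gbi i j * gb j k = (i == k)%:R.
Proof. by rewrite -gbK; apply: eq_bigr => j _; rewrite mulrC gbC (gbiC i j). Qed.

Lemma up1K w j : \sum_k up1 w k * gb k j = w j.
Proof.
transitivity (\sum_i w i * \sum_k gb j k * gbi k i).
  rewrite /up1; under eq_bigr do rewrite mulr_suml.
  rewrite exchange_big; apply: eq_bigr => i _; rewrite mulr_sumr; apply: eq_bigr => k _ /=.
  by rewrite (gbC k j); ring.
by under eq_bigr do rewrite gbK; rewrite sum_kron.
Qed.

(** How the connection coefficients are found: since xi is orthogonal to the fr_j and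
    gbar is invertible, the frame components of X can be read off from its scalar
    products with the frame. *)
Lemma vec_intro X f v : gg X e0 = - N ^+ 2 * f ->
  (forall j, gg X (fr j) = \sum_k v k * gb k j) -> X = vec f v.
Proof.
move=> X0 XS; rewrite [LHS]vecK; apply: eq_vec.
  move: X0; rewrite [X in gg X]vecK gg_vec0 => e.
  (* The coefficient f is recovered by dividing by - Phi^2. *)
  have lapse2K u : u = - NI ^+ 2 * (- N ^+ 2 * u) by ring: (lapseK S).
  by rewrite [LHS]lapse2K e -lapse2K.
move=> k; have unlow (u : 'I_3 -> A) : u k = \sum_j (\sum_l u l * gb l j) * gbi j k.
  rewrite -[LHS]sum_kron.
  under [RHS]eq_bigr do rewrite mulr_suml.
  rewrite exchange_big; apply: eq_bigr => l _ /=.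
  by rewrite eq_sym -gbK mulr_sumr; apply: eq_bigr => j _; rewrite mulrA.
rewrite (unlow v); have /= -> := unlow (fun l => X 0 (es l)); apply: eq_bigr => j _.
by rewrite -XS {2}(vecK X) gg_vec_fr.
Qed.

(** * Connection coefficients of the adapted frame *)

Lemma gg_conn_e0 X : gg (conn X e0) e0 = - N * dirder X N.
Proof.
apply: half_eq; have := conn_metric X e0 e0.
rewrite [gg e0 (conn X e0)]ggC gg00 dirderN expr2 dirderM => <-; ring.
Qed.

Lemma conn_0fr i : conn e0 (fr i) = conn (fr i) e0 + acc_a i *: e0.
Proof. by rewrite -bracket_0fr -conn_torsion addrC subrK. Qed.

(** The part symmetric in i and j is half the derivative of gbar along xi, because
    [xi, fr_i] is vertical; the skew part is the vertical component of [fr_i, fr_j].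
    These are Theta and Phi^2 omega. *)
Lemma gg_conn_fr0 i j : gg (conn (fr i) e0) (fr j) = Kl j i.
Proof.
have sym : d0 (gb j i) = gg (conn (fr i) e0) (fr j) + gg (conn (fr j) e0) (fr i).
  rewrite gbE conn_metric !conn_0fr ggDl ggDr ggZl ggZr gg_0fr gg_fr0 !mulr0 !addr0.
  by rewrite addrC [gg (fr j) _]ggC.
have lower k l : gg (conn (fr k) e0) (fr l) = - gg e0 (conn (fr k) (fr l)).
  by apply/eqP; rewrite -addr_eq0 -conn_metric gg_0fr dirder0.
have anti : gg (conn (fr j) e0) (fr i) - gg (conn (fr i) e0) (fr j)
    = - N ^+ 2 * (vort j i + vort j i).
  rewrite !lower opprK addrC -ggBr conn_torsion bracket_fr ggZr gg00 (vort_anti j i).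
  by ring.
apply: half_eq; rewrite !KlE !expnE addrACA halfD sym.
by rewrite -[gg (conn (fr j) e0) (fr i)](subrK (gg (conn (fr i) e0) (fr j))) anti; ring.
Qed.

Lemma up_Kl_low i j : \sum_k up Kl k i * gb k j = Kl j i.
Proof. exact: (up1K (fun l => Kl l i)). Qed.

(** The coefficient of xi comes from differentiating g(xi, xi) = - Phi^2, whence c_i;
    exchanging the two fields then adds a_i to it, by their bracket. *)
Lemma conn_s0 i : conn (fr i) e0 = vec (acc_c i) (fun k => up Kl k i).
Proof.
apply: vec_intro => [|j]; last by rewrite gg_conn_fr0 up_Kl_low.
by rewrite gg_conn_e0 acc_cE; ring: (lapseK S).
Qed.

Lemma conn_0s i : conn e0 (fr i) = vec (acc_b i) (fun k => up Kl k i).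
Proof.
rewrite conn_0fr conn_s0; apply: vec_intro => [|j].
  by rewrite ggDl ggZl gg_vec0 gg00 acc_bE; ring.
by rewrite ggDl ggZl gg_vec_fr gg_0fr mulr0 addr0.
Qed.

Lemma conn_00 : conn e0 e0 = vec psi (fun k => N ^+ 2 * up1 acc_b k).
Proof.
apply: vec_intro => [|j].
  by rewrite gg_conn_e0 psiE; ring: (lapseK S).
have /eqP := conn_metric e0 e0 (fr j).
rewrite gg_0fr dirder0 conn_0s [gg e0 (vec _ _)]ggC gg_vec0 eq_sym addr_eq0 => /eqP ->.
under eq_bigr do rewrite -mulrA.
by rewrite -mulr_sumr up1K; ring.
Qed.

(** The Koszul formula.  The brackets of the fr_i are vertical, hence invisible to a
    scalar product with fr_k, and the formula reduces to the one for coordinate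
    fields. *)
Lemma conn_ss i j : conn (fr j) (fr i) = vec (NI ^+ 2 * Kl i j) (fun k => Gb i k j).
Proof.
apply: vec_intro => [|k].
  have /eqP := conn_metric (fr j) (fr i) e0.
  rewrite gg_fr0 dirder0 [gg (fr i) _]ggC gg_conn_fr0 eq_sym addr_eq0 => /eqP ->.
  by ring: (lapseK S).
have -> : \sum_l Gb i l j * gb l k =
    h * (di i (gb k j) + di j (gb k i) - di k (gb i j)).
  rewrite -(up1K (fun l => di i (gb l j) + di j (gb l i) - di l (gb i j)) k) mulr_sumr.
  by apply: eq_bigr => l _; rewrite GbE mulrA.
have m a b c : di a (gb b c) = gg (conn (fr a) (fr b)) (fr c) + gg (conn (fr a) (fr c)) (fr b).
  by rewrite gbE conn_metric [gg (fr b) _]ggC.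
have t a b c : gg (conn (fr a) (fr b)) (fr c) = gg (conn (fr b) (fr a)) (fr c).
  apply/eqP; rewrite -subr_eq0 -ggBl conn_torsion bracket_fr ggZl gg_0fr mulr0 //.
rewrite !m (t i k j) (t i j k) (t k j i); apply: half_eq; rewrite halfD; ring.
Qed.

Lemma thetD X Y : thet (X + Y) = thet X + thet Y.
Proof.
rewrite /thet addmxE addrACA -big_split; congr (_ + _).
by apply: eq_bigr => k _; rewrite addmxE mulrDl.
Qed.

Lemma thetZ f X : thet (f *: X) = f * thet X.
Proof.
rewrite /thet scalemxE mulrDr mulr_sumr; congr (_ + _).
by apply: eq_bigr => k _; rewrite scalemxE mulrA.
Qed.

Lemma thet0 : thet 0 = 0.
Proof. by have := thetZ 0 0; rewrite scale0r mul0r. Qed.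

Lemma thetN X : thet (- X) = - thet X.
Proof. by rewrite -scaleN1r thetZ mulN1r. Qed.

Lemma thet_vec f v : thet (vec f v) = f.
Proof.
rewrite /thet vec0 [X in _ + X](_ : _ = \sum_l v l * slope l) ?subrK //.
by apply: eq_bigr => k _; rewrite vecS.
Qed.

Lemma vec_ext X Y :
  thet X = thet Y -> (forall k, X 0 (es k) = Y 0 (es k)) -> X = Y.
Proof. by move=> e eS; rewrite (vecK X) (vecK Y); apply: eq_vec. Qed.

(** The Leibniz rule in frame components; with the four coefficients above it makes
    second covariant derivatives of frame fields a mechanical expansion. *)
Lemma conn_vec X f v f0 v0 F V :
  conn X e0 = vec f0 v0 -> (forall l, conn X (fr l) = vec (F l) (V l)) ->
  conn X (vec f v) = vec (dirder X f + f * f0 + \sum_l v l * F l)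
                         (fun k => dirder X (v k) + f * v0 k + \sum_l v l * V l k).
Proof.
move=> c0 cs.
have e0E : e0 = vec 1 (fun=> 0).
  by rewrite vecE scale1r big1 ?addr0 // => l _; rewrite scale0r.
have frE l : fr l = vec 0 (fun k => (k == l)%:R).
  apply: row_eq => [|k]; rewrite ?vecS ?frS // vec0 fr0 sub0r.
  by under eq_bigr do rewrite mulrC; rewrite sum_kron.
have thet_sum (I : finType) (B : I -> vect) : thet (\sum_i B i) = \sum_i thet (B i).
  exact: (big_morph thet thetD thet0).
rewrite [vec f v]vecE connDr connZr conn_sumr c0.
under eq_bigr do rewrite connZr cs.
apply: vec_ext => [|k].
  rewrite !thetD !thetZ thet_sum !thet_vec {1}e0E thet_vec mulr1; congr (_ + _).
  by apply: eq_bigr => l _; rewrite thetD !thetZ {1}frE !thet_vec mulr0 add0r.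
rewrite !addmxE !scalemxE summxE !vecS ecoordE mulr0.
rewrite [X in _ + X](_ : _ = dirder X (v k) + \sum_l v l * V l k); first by ring.
rewrite -[dirder X (v k)](sum_kron (fun l => dirder X (v l))) -big_split.
by apply: eq_bigr => l _; rewrite addmxE !scalemxE vecS frS eq_sym.
Qed.

Lemma conn_s_vec k f v : conn (fr k) (vec f v) =
  vec (di k f + f * acc_c k + NI ^+ 2 * \sum_l v l * Kl l k)
      (fun j => di k (v j) + f * up Kl j k + \sum_l v l * Gb l j k).
Proof.
rewrite (conn_vec _ _ (conn_s0 k) (fun l => conn_ss l k)).
by apply: eq_vec => //; rewrite mulr_sumr; congr (_ + _); apply: eq_bigr => l _; ring.
Qed.

Lemma conn_0_vec f v : conn e0 (vec f v) =
  vec (d0 f + f * psi + \sum_l v l * acc_b l)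
      (fun j => d0 (v j) + f * (N ^+ 2 * up1 acc_b j) + \sum_l v l * up Kl j l).
Proof. exact: (conn_vec _ _ conn_00 conn_0s). Qed.

(** * Curvature components in the adapted frame *)

Local Notation b_up := (up1 acc_b).
Local Notation Km := (up Kl).

(** The spatial part of the Levi-Civita connection: [thet] is the coefficient of xi. *)
Definition barconn : vect -> vect -> vect :=
  locked (fun X Y => conn X Y - thet (conn X Y) *: e0).

Lemma barconnE X Y f v : conn X Y = vec f v -> barconn X Y = vec 0 v.
Proof.
move=> e; rewrite /barconn -lock e thet_vec !vecE scale0r add0r.
by rewrite addrC addrA addNr add0r.
Qed.

Lemma barconnZl f X Y : barconn (f *: X) Y = f *: barconn X Y.
Proof. by rewrite /barconn -!lock connZl thetZ -scalerA -scalerBr. Qed.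

Lemma barconnNl X Y : barconn (- X) Y = - barconn X Y.
Proof. by rewrite -!scaleN1r barconnZl. Qed.

Definition barriem X Y Z :=
  barconn X (barconn Y Z) - barconn Y (barconn X Z) - barconn (bracket X Y) Z.

(** Components of the curvature of the spatial connection, and Theta.  Coordinate
    component k of a vector is its component along fr_k. *)
Definition Rb := locked (fun i j k l => barriem (fr l) (fr k) (fr i) 0 (es j)).
Definition Rb0 := locked (fun i j k => barriem (fr k) e0 (fr i) 0 (es j)).
Definition expansion := locked (\sum_k up expn k k).

Lemma expansionE : expansion = \sum_k up expn k k.
Proof. by rewrite /expansion -lock. Qed.

(** The covariant derivatives w_{i|j}, v^i_{|j}, T^j_{i|k} and T_{ij|0}. *)
Definition hcov_low := locked (fun (w : 'I_3 -> A) i j =>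
  di j (w i) - \sum_l w l * Gb i l j).
Definition hcov_up := locked (fun (v : 'I_3 -> A) i j =>
  di j (v i) + \sum_l v l * Gb l i j).
Definition hcov_mixed := locked (fun (T : 'I_3 -> 'I_3 -> A) j i k =>
  di k (T j i) + \sum_l T l i * Gb l j k - \sum_l T j l * Gb i l k).
Definition vcov_low2 := locked (fun (T : 'I_3 -> 'I_3 -> A) i j =>
  d0 (T i j) - \sum_l T l j * Km l i - \sum_l T i l * Km l j).

Lemma hcov_lowE w i j : hcov_low w i j = di j (w i) - \sum_l w l * Gb i l j.
Proof. by rewrite /hcov_low -lock. Qed.

Lemma hcov_upE v i j : hcov_up v i j = di j (v i) + \sum_l v l * Gb l i j.
Proof. by rewrite /hcov_up -lock. Qed.

Lemma hcov_mixedE T j i k : hcov_mixed T j i k =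
  di k (T j i) + \sum_l T l i * Gb l j k - \sum_l T j l * Gb i l k.
Proof. by rewrite /hcov_mixed -lock. Qed.

Lemma vcov_low2E T i j : vcov_low2 T i j =
  d0 (T i j) - \sum_l T l j * Km l i - \sum_l T i l * Km l j.
Proof. by rewrite /vcov_low2 -lock. Qed.

Lemma barconn_s_vec k v : barconn (fr k) (vec 0 v) =
  vec 0 (fun j => di k (v j) + \sum_l v l * Gb l j k).
Proof.
rewrite (barconnE (conn_s_vec _ _ _)); apply: eq_vec => // j.
by rewrite mul0r addr0.
Qed.

Lemma barconn_0_vec v : barconn e0 (vec 0 v) =
  vec 0 (fun j => d0 (v j) + \sum_l v l * Km j l).
Proof.
rewrite (barconnE (conn_0_vec _ _)); apply: eq_vec => // j.
by rewrite mul0r addr0.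
Qed.

Lemma RbE i j k l : Rb i j k l =
  di l (Gb i j k) + \sum_m Gb i m k * Gb m j l
  - (di k (Gb i j l) + \sum_m Gb i m l * Gb m j k)
  + (vort l k + vort l k) * Km j i.
Proof.
set rhs := RHS; rewrite /Rb -lock /barriem !(barconnE (conn_ss _ _)) !barconn_s_vec bracket_fr.
rewrite barconnZl (barconnE (conn_0s _)).
by rewrite !addmxE !oppmxE scalemxE !vecS /rhs; ring.
Qed.

Lemma Rb0E i j k : Rb0 i j k =
  di k (Km j i) + \sum_l Km l i * Gb l j k
  - (d0 (Gb i j k) + \sum_l Gb i l k * Km j l) + acc_a k * Km j i.
Proof.
set rhs := RHS; rewrite /Rb0 -lock /barriem (barconnE (conn_0s _)) (barconnE (conn_ss _ _)).
rewrite barconn_s_vec barconn_0_vec bracketNC bracket_0fr.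
rewrite barconnNl barconnZl (barconnE (conn_0s _)).
by rewrite !addmxE !oppmxE scalemxE !vecS /rhs; ring.
Qed.

(** Here and in [riem_sss], the spacetime curvature differs from that of the spatial
    connection by products of the coefficients through which the Levi-Civita
    connection leaves and re-enters the spatial distribution: b_i or K_ij / Phi^2
    on the way out, K^k_i or Phi^2 b^k on the way back. *)
Lemma riem_s0s i j k : riem (fr k) e0 (fr i) 0 (es j) =
  Rb0 i j k + acc_b i * Km j k - Kl i k * b_up j.
Proof.
rewrite riemE conn_0s conn_ss conn_s_vec conn_0_vec bracketNC bracket_0fr.
rewrite connNl connZl conn_0s !addmxE !oppmxE scalemxE !(vecS _ _ j) Rb0E.
by ring: (lapseK S).
Qed.

Lemma riem_sss i j k l : riem (fr l) (fr k) (fr i) 0 (es j) =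
  Rb i j k l + NI ^+ 2 * (Kl i k * Km j l - Kl i l * Km j k).
Proof.
rewrite riemE !conn_ss !conn_s_vec bracket_fr connZl conn_0s.
by rewrite !addmxE !oppmxE scalemxE !vecS RbE; ring.
Qed.

Lemma riem_s00 j k : riem (fr k) e0 e0 0 (es j) =
  N ^+ 2 * (hcov_up b_up j k + acc_b k * b_up j) + psi * Km j k
  - d0 (Km j k) - \sum_l Km l k * Km j l.
Proof.
rewrite riemE conn_00 conn_s0 conn_s_vec conn_0_vec bracketNC bracket_0fr.
rewrite connNl connZl conn_00 !addmxE !oppmxE scalemxE !(vecS _ _ j).
have -> : \sum_l N ^+ 2 * b_up l * Gb l j k = N ^+ 2 * \sum_l b_up l * Gb l j k.
  by rewrite mulr_sumr; apply: eq_bigr => l _; ring.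
have e : di k N = N * acc_c k by rewrite acc_cE; ring: (lapseK S).
rewrite expr2 !dirderM e !hcov_upE (acc_bE k); ring.
Qed.

(** The vertical part, needed for the xi term of the trace that defines Ric(fr_j, fr_i). *)
Lemma thet_riem_0ss i j : thet (riem e0 (fr j) (fr i)) =
  NI ^+ 2 * (d0 (Kl i j) - psi * Kl i j - \sum_l Km l i * Kl l j)
  - hcov_low acc_b i j - acc_b i * acc_b j.
Proof.
rewrite riemE conn_ss conn_0s conn_s_vec conn_0_vec bracket_0fr connZl conn_0s.
rewrite !(thetD, thetZ, thetN, thet_vec).
have e : d0 N = N * psi by rewrite psiE; ring: (lapseK S).
rewrite (_ : acc_b i * acc_b j = acc_b i * (acc_a j + acc_c j)); last by rewrite -acc_bE.
rewrite !expr2 !dirderM dirderI e !hcov_lowE.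
under [\sum_l acc_b l * _]eq_bigr do rewrite mulrC.
ring: (lapseK S).
Qed.

Lemma riem_self X Y : riem X X Y = 0.
Proof.
have br0 : bracket X X = 0 by apply/rowP => c; rewrite bracketE subrr mxE.
by rewrite riemE br0 conn0l subrr subr0.
Qed.

(** * The Ricci tensor in the adapted frame *)

(** A trace may be computed in any frame; the adapted frame differs from the coordinate
    frame by multiples of xi. *)
Lemma ric_frame X Y :
  ric X Y = thet (riem e0 X Y) + \sum_k riem (fr k) X Y 0 (es k).
Proof.
rewrite ricE sum_es /thet -addrA -big_split; congr (_ + _).
apply: eq_bigr => k _ /=.
have -> : ecoord (es k) = slope k *: e0 + fr k by rewrite frE addrC subrK.
by rewrite riemDl riemZl addmxE scalemxE mulrC.
Qed.

Lemma expnC i j : expn i j = expn j i.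
Proof. by rewrite !expnE gbC. Qed.

(** A skew form contracted with the symmetric inverse of gbar.  Hence K and Theta have
    the same trace. *)
Lemma trace_vort : \sum_k up vort k k = 0.
Proof.
apply: half_eq; rewrite addr0 /up {2}exchange_big /= -big_split big1 //= => k _.
rewrite -big_split big1 //= => l _.
by rewrite (vort_anti l k) (gbiC l k); ring.
Qed.

Lemma up_Kl k i : Km k i = up expn k i + N ^+ 2 * up vort k i.
Proof.
rewrite /up mulr_sumr -big_split; apply: eq_bigr => l _ /=.
by rewrite KlE; ring.
Qed.

Lemma trace_Km : \sum_k Km k k = expansion.
Proof.
under eq_bigr do rewrite up_Kl.
by rewrite expansionE big_split -mulr_sumr /= trace_vort mulr0 addr0.
Qed.

Lemma ric_0s i : ric e0 (fr i) =
  \sum_k Rb0 i k k + expansion * acc_b i - \sum_k Kl i k * b_up k.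
Proof.
rewrite ric_frame riem_self thet0 add0r; under eq_bigr do rewrite riem_s0s.
by rewrite sumrB big_split -mulr_sumr trace_Km mulrC.
Qed.

(** The term K^l_i K_lj from the vertical part combines with the product K K of
    [riem_sss] into K_{ij|0}. *)
Lemma ric_ss i j : ric (fr j) (fr i) =
  \sum_k Rb i k j k - hcov_low acc_b i j - acc_b i * acc_b j
  + NI ^+ 2 * (vcov_low2 Kl i j + (expansion - psi) * Kl i j).
Proof.
rewrite ric_frame; under eq_bigr do rewrite riem_sss.
rewrite thet_riem_0ss big_split -mulr_sumr sumrB -mulr_sumr trace_Km !vcov_low2E /=.
under [\sum_l Kl l j * _]eq_bigr do rewrite mulrC.
ring.
Qed.

(** Since the Ricci tensor is symmetric, [ric_ss] may be averaged over i and j; the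
    skew part Phi^2 omega of K then drops out, also inside the derivative. *)
Lemma ric_ss_sym i j : ric (fr i) (fr j) + ric (fr i) (fr j) =
  \sum_k Rb i k j k + \sum_k Rb j k i k
  - (hcov_low acc_b i j + hcov_low acc_b j i)
  - (acc_b i * acc_b j + acc_b i * acc_b j)
  + NI ^+ 2 * (vcov_low2 expn i j + vcov_low2 expn i j
               + (expansion - psi) * (expn i j + expn i j)).
Proof.
rewrite {1}ricC !ric_ss.
have K2 k l : Kl k l + Kl l k = expn k l + expn k l.
  by rewrite !KlE (vort_anti l k) (expnC l k); ring.
have c2 : vcov_low2 Kl i j + vcov_low2 Kl j i = vcov_low2 expn i j + vcov_low2 expn i j.
  (* The two orders of the index on K add up to the symmetric part. *)
  have s k l : \sum_m Kl m k * Km m l + \sum_m Kl k m * Km m l =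
      \sum_m expn m k * Km m l + \sum_m expn k m * Km m l.
    rewrite -!big_split; apply: eq_bigr => m _ /=.
    by rewrite -!mulrDl K2 (expnC k m).
  have s' k l : \sum_m expn m k * Km m l = \sum_m expn k m * Km m l.
    by apply: eq_bigr => m _; rewrite expnC.
  rewrite !vcov_low2E.
  transitivity (d0 (Kl i j + Kl j i) - (\sum_m Kl m j * Km m i + \sum_m Kl j m * Km m i)
    - (\sum_m Kl m i * Km m j + \sum_m Kl i m * Km m j)).
    by rewrite (dirderD _ (Kl i j) (Kl j i)); ring.
  by rewrite !s K2 (dirderD _ (expn i j) (expn i j)) (s' i j) (s' j i); ring.
transitivity (\sum_k Rb i k j k + \sum_k Rb j k i k
  - (hcov_low acc_b i j + hcov_low acc_b j i)
  - (acc_b i * acc_b j + acc_b i * acc_b j)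
  + NI ^+ 2 * (vcov_low2 Kl i j + vcov_low2 Kl j i
               + (expansion - psi) * (Kl i j + Kl j i))); first by ring.
by rewrite c2 K2.
Qed.

Lemma ric_00 : ric e0 e0 =
  N ^+ 2 * (\sum_k hcov_up b_up k k + \sum_k acc_b k * b_up k) + psi * expansion
  - d0 expansion - \sum_k \sum_l Km l k * Km k l.
Proof.
rewrite ric_frame riem_self thet0 add0r; under eq_bigr do rewrite riem_s00.
by rewrite !sumrB [in LHS]big_split -!mulr_sumr [in LHS]big_split -dirder_sum trace_Km.
Qed.

(** * Metric contractions *)

Definition form_mx (T : 'I_3 -> 'I_3 -> A) : 'M[A]_3 := \matrix_(i, j) T i j.

Local Notation B := (form_mx gb).
Local Notation BI := (form_mx gbi).
Local Notation dmx X := (map_mx (dirder X)).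

Definition contract T := \sum_i \sum_j gbi i j * T i j.

Lemma contractE T : contract T = \tr (BI *m form_mx T).
Proof.
rewrite /contract exchange_big; apply: eq_bigr => j _; rewrite mxE.
by apply: eq_bigr => i _; rewrite !mxE gbiC.
Qed.

Lemma trace_up T : \sum_k up T k k = \tr (BI *m form_mx T).
Proof.
by apply: eq_bigr => k _; rewrite mxE; apply: eq_bigr => l _; rewrite !mxE.
Qed.

Lemma mulBBI : B *m BI = 1%:M.
Proof.
apply/matrixP => i j; rewrite !mxE eq_sym -gbK; apply: eq_bigr => k _.
by rewrite !mxE.
Qed.

Lemma mulBIB : BI *m B = 1%:M.
Proof.
apply/matrixP => i j; rewrite !mxE -gbiK; apply: eq_bigr => k _.
by rewrite !mxE.
Qed.

Lemma dmxM X m n p (M : 'M[A]_(m, n)) (L : 'M[A]_(n, p)) :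
  dmx X (M *m L) = dmx X M *m L + M *m dmx X L.
Proof.
apply/matrixP => i j; rewrite !mxE dirder_sum -big_split; apply: eq_bigr => k _ /=.
by rewrite !mxE dirderM.
Qed.

Lemma dmx_tr X n (M : 'M[A]_n) : dirder X (\tr M) = \tr (dmx X M).
Proof. by rewrite dirder_sum; apply: eq_bigr => i _; rewrite mxE. Qed.

Lemma mxtraceN n (M : 'M[A]_n) : \tr (- M) = - \tr M.
Proof. exact: raddfN. Qed.

Lemma dmx_inv X : dmx X BI = - (BI *m dmx X B *m BI).
Proof.
have : dmx X (BI *m B) = 0.
  by rewrite mulBIB; apply/matrixP => i j; rewrite !mxE dirder_ecoord0.
rewrite dmxM => /eqP; rewrite addr_eq0 => /eqP e.
by rewrite -[LHS]mulmx1 -mulBBI mulmxA e mulNmx.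
Qed.

Lemma dmx_d0B : dmx e0 B = form_mx Kl + (form_mx Kl)^T.
Proof.
apply/matrixP => i j; rewrite !mxE !KlE (vort_anti j i) (expnC j i).
transitivity (expn i j + expn i j); last by ring.
by rewrite expnE halfD.
Qed.

Lemma form_mxK T : form_mx (up T) = BI *m form_mx T.
Proof.
by apply/matrixP => i j; rewrite !mxE; apply: eq_bigr => k _; rewrite !mxE.
Qed.

Lemma form_sym T : (forall i j, T i j = T j i) -> (form_mx T)^T = form_mx T.
Proof. by move=> e; apply/matrixP => i j; rewrite !mxE e. Qed.

(** The derivative along xi of the inverse of gbar produces exactly the two K terms of
    Theta_{ij|0}, because the derivative of gbar is K plus its transpose. *)
Lemma contract_cov0_expn : contract (vcov_low2 expn) = d0 expansion.
Proof.
rewrite contractE expansionE trace_up dmx_tr dmxM dmx_inv dmx_d0B.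
have -> : form_mx (vcov_low2 expn) =
    dmx e0 (form_mx expn) - (BI *m form_mx Kl)^T *m form_mx expn
    - form_mx expn *m (BI *m form_mx Kl).
  rewrite -form_mxK; apply/matrixP => i j; rewrite !mxE !vcov_low2E.
  congr (_ - _ - _); apply: eq_bigr => k _; rewrite !mxE //.
  by rewrite mulrC.
rewrite trmx_mul (form_sym gbiC).
move: (form_mx expn) (form_mx Kl) (dmx e0 _) => T K dT.
rewrite !mulmxBr mulNmx mulmxDr !mulmxDl opprD !mulmxA.
rewrite !(mxtraceD, mxtraceN) -[BI *m T *m BI *m K]mulmxA.
by rewrite [\tr (BI *m T *m _)]mxtrace_mulC !mulmxA; ring.
Qed.

(** The spatial connection is metric: [conn_metric] on frame fields, where vertical
    parts are orthogonal to the fr_k. *)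
Lemma di_gb i j k : di i (gb j k) =
  \sum_l Gb j l i * gb l k + \sum_l Gb k l i * gb l j.
Proof.
by rewrite gbE conn_metric !conn_ss [gg (fr j) _]ggC !gg_vec_fr.
Qed.

(** Raising an index commutes with the spatial covariant derivative, since the latter
    annihilates gbar and hence its inverse. *)
Lemma cov_up_up1 w i j : hcov_up (up1 w) i j = \sum_l hcov_low w l j * gbi l i.
Proof.
pose wr : 'rV[A]_3 := \row_l w l.
pose C := form_mx (fun k l => Gb k l j).
have dB : dmx (fr j) B = C *m B + B *m C^T.
  apply/matrixP => k l; rewrite !mxE di_gb; congr (_ + _); apply: eq_bigr => m _.
    by rewrite !mxE.
  by rewrite !mxE gbC mulrC.
have e : dmx (fr j) (wr *m BI) + wr *m BI *m C = (dmx (fr j) wr - wr *m C^T) *m BI.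
  rewrite dmxM dmx_inv dB !(mulmxDr, mulmxDl, mulmxN, mulNmx) !mulmxA.
  rewrite -[wr *m BI *m C *m B *m BI]mulmxA mulBBI mulmx1.
  by rewrite -[wr *m BI *m B]mulmxA mulBIB mulmx1 opprD addrA [_ - _ - _]addrAC subrK.
have up1E k : up1 w k = (wr *m BI) 0 k.
  by rewrite mxE; apply: eq_bigr => l _; rewrite !mxE mulrC gbiC.
have /rowP/(_ i) := e; rewrite [RHS]mxE [LHS]mxE.
have -> : (dmx (fr j) (wr *m BI)) 0 i = di j (up1 w i) by rewrite mxE -up1E.
have -> : (wr *m BI *m C) 0 i = \sum_l up1 w l * Gb l i j.
  by rewrite mxE; apply: eq_bigr => l _; rewrite up1E [C _ _]mxE.
rewrite hcov_upE => ->; apply: eq_bigr => l _; rewrite hcov_lowE !mxE; congr ((_ - _) * _).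
by apply: eq_bigr => m _; rewrite !mxE.
Qed.

Lemma contract_cov_low w : contract (hcov_low w) = \sum_k hcov_up (up1 w) k k.
Proof.
rewrite /contract exchange_big; apply: eq_bigr => k _; rewrite cov_up_up1.
by apply: eq_bigr => l _; rewrite mulrC.
Qed.

(** The trace of the connection coefficients is half the logarithmic derivative of the
    determinant of gbar; the other two terms of Gamma cancel by symmetry. *)
Lemma trace_Gb i : \sum_k Gb i k k = h * \tr (BI *m dmx (fr i) B).
Proof.
transitivity (h * \sum_k \sum_l gbi k l * di i (gb l k)
  + h * (\sum_k \sum_l gbi k l * di k (gb l i) - \sum_k \sum_l gbi k l * di l (gb i k))).
  rewrite -mulrDr -sumrB -big_split mulr_sumr; apply: eq_bigr => k _ /=.
  rewrite GbE; congr (_ * _); rewrite -sumrB -big_split; apply: eq_bigr => l _ /=.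
  by ring.
have -> : \sum_k \sum_l gbi k l * di k (gb l i) = \sum_k \sum_l gbi k l * di l (gb i k).
  rewrite exchange_big; apply: eq_bigr => l _; apply: eq_bigr => k _ /=.
  by rewrite (gbiC k l) (gbC l i).
rewrite subrr mulr0 addr0; congr (_ * _); apply: eq_bigr => k _.
by rewrite mxE; apply: eq_bigr => l _; rewrite !mxE.
Qed.

Lemma expansion_tr : expansion = h * \tr (BI *m dmx e0 B).
Proof.
rewrite expansionE trace_up -mxtraceZ scalemxAr; congr (\tr (_ *m _)).
by apply/matrixP => i j; rewrite !mxE expnE.
Qed.

Lemma dmx_comm i : dmx e0 (dmx (fr i) B) - dmx (fr i) (dmx e0 B) = acc_a i *: dmx e0 B.
Proof.
apply/matrixP => j k; rewrite !mxE -dirder_bracket bracket_0fr.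
by rewrite dirderZl.
Qed.

(** Both the trace of Gamma and Theta are half a logarithmic derivative of det gbar,
    along fr_i and along xi.  The two derivations commute up to [xi, fr_i] = a_i xi. *)
Lemma d0_trace_Gb i : d0 (\sum_k Gb i k k) = di i expansion + acc_a i * expansion.
Proof.
rewrite trace_Gb expansion_tr !dirderM !dirder_half !mul0r !add0r mulrCA -mulrDr; congr (_ * _).
have -> : acc_a i * \tr (BI *m dmx e0 B) = \tr (BI *m (acc_a i *: dmx e0 B)).
  by rewrite -scalemxAr mxtraceZ.
rewrite -dmx_comm !dmx_tr !dmxM !dmx_inv mulmxBr.
rewrite !(mxtraceD, mxtraceN) !mulNmx !mxtraceN.
rewrite -[BI *m dmx (fr i) B *m BI *m _]mulmxA [\tr (BI *m dmx (fr i) B *m _)]mxtrace_mulC.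
by rewrite !mulmxA; ring.
Qed.

Lemma trace_Rb0 i : \sum_k Rb0 i k k =
  \sum_k hcov_mixed Km k i k - di i expansion - acc_a i * expansion + \sum_k acc_a k * Km k i.
Proof.
under eq_bigr do rewrite Rb0E.
(* The time derivatives of Gamma sum to the time derivative of its trace. *)
have e : d0 (\sum_k Gb i k k) = \sum_k d0 (Gb i k k) by rewrite dirder_sum.
rewrite d0_trace_Gb in e.
rewrite big_split /=; congr (_ + _).
rewrite -addrA -opprD e -sumrB; apply: eq_bigr => k _.
rewrite !hcov_mixedE; under [\sum_l Km k l * _]eq_bigr do rewrite mulrC.
by ring.
Qed.

(** [trace_Rb0] turns the curvature trace into the divergence of K; what remains is to
    split K into Theta and Phi^2 omega.  Differentiating Phi^2 gives 2 Phi^2 c_k, which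
    together with the terms in a_k and b_k amounts to 2 b_k + c_k contracted with
    omega^k_i. *)
Lemma mixed_forms i :
  \sum_k Rb0 i k k + expansion * acc_b i - \sum_k Kl i k * b_up k =
  \sum_k hcov_mixed (up expn) k i k - di i expansion + expansion * acc_c i
  - \sum_k expn i k * up1 acc_c k
  + N ^+ 2 * (\sum_k hcov_mixed (up vort) k i k + \sum_k acc_c k * up vort k i
              - 2 * \sum_k vort i k * b_up k).
Proof.
have cov_K k : hcov_mixed Km k i k = hcov_mixed (up expn) k i k
    + N ^+ 2 * hcov_mixed (up vort) k i k + 2 * N ^+ 2 * (acc_c k * up vort k i).
  have e : di k N = N * acc_c k by rewrite acc_cE; ring: (lapseK S).
  rewrite !hcov_mixedE.
  have s1 : \sum_l Km l i * Gb l k k =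
      \sum_l up expn l i * Gb l k k + N ^+ 2 * \sum_l up vort l i * Gb l k k.
    rewrite mulr_sumr -big_split; apply: eq_bigr => l _ /=.
    by rewrite up_Kl; ring.
  have s2 : \sum_l Km k l * Gb i l k =
      \sum_l up expn k l * Gb i l k + N ^+ 2 * \sum_l up vort k l * Gb i l k.
    rewrite mulr_sumr -big_split; apply: eq_bigr => l _ /=.
    by rewrite up_Kl; ring.
  rewrite s1 s2 up_Kl (dirderD _ (up expn k i)) (dirderM _ (N ^+ 2)).
  by rewrite expr2 (dirderM _ N) e; ring.
have swap (T : 'I_3 -> 'I_3 -> A) (w : 'I_3 -> A) :
    \sum_k w k * up T k i = \sum_k T k i * up1 w k.
  rewrite /up /up1; under eq_bigr do rewrite mulr_sumr.
  rewrite exchange_big; apply: eq_bigr => l _; rewrite mulr_sumr; apply: eq_bigr => k _ /=.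
  by rewrite (gbiC k l); ring.
have swapV (w : 'I_3 -> A) : \sum_k vort i k * up1 w k = - \sum_k w k * up vort k i.
  rewrite swap -sumrN; apply: eq_bigr => k _.
  by rewrite (vort_anti i k) mulNr.
have swapE (w : 'I_3 -> A) : \sum_k expn i k * up1 w k = \sum_k w k * up expn k i.
  by rewrite swap; apply: eq_bigr => k _; rewrite (expnC i k).
have KlS (w : 'I_3 -> A) : \sum_k Kl i k * up1 w k =
    \sum_k expn i k * up1 w k + N ^+ 2 * \sum_k vort i k * up1 w k.
  rewrite mulr_sumr -big_split; apply: eq_bigr => k _ /=.
  by rewrite KlE; ring.
have KmS : \sum_k acc_a k * Km k i =
    \sum_k acc_a k * up expn k i + N ^+ 2 * \sum_k acc_a k * up vort k i.
  rewrite mulr_sumr -big_split; apply: eq_bigr => k _ /=.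
  by rewrite up_Kl; ring.
have splitb T : \sum_k acc_b k * up T k i =
    \sum_k acc_a k * up T k i + \sum_k acc_c k * up T k i.
  rewrite -big_split; apply: eq_bigr => k _ /=.
  by rewrite acc_bE mulrDl.
rewrite trace_Rb0 KmS KlS !swapV !swapE !splitb (acc_bE i).
have -> : \sum_k hcov_mixed Km k i k = \sum_k hcov_mixed (up expn) k i k
    + N ^+ 2 * \sum_k hcov_mixed (up vort) k i k
    + 2 * N ^+ 2 * \sum_k acc_c k * up vort k i.
  rewrite !mulr_sumr -!big_split; apply: eq_bigr => k _.
  exact: cov_K.
by ring.
Qed.

(** T_kl T^kl. *)
Definition sqn (T : 'I_3 -> 'I_3 -> A) :=
  \sum_k \sum_l T k l * \sum_i \sum_j gbi k i * gbi l j * T i j.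

Lemma sqn_tr T : sqn T = \tr ((form_mx T)^T *m BI *m form_mx T *m BI).
Proof.
rewrite /sqn exchange_big; apply: eq_bigr => l _; rewrite -!mulmxA mxE.
apply: eq_bigr => k _; rewrite !mxE; congr (_ * _).
under [RHS]eq_bigr do rewrite mxE.
apply: eq_bigr => i _; rewrite mxE mulr_sumr; apply: eq_bigr => j _.
by rewrite !mxE (gbiC l j); ring.
Qed.

(** With t = Theta / 3 this is sigma^2 = Theta_hk Theta^hk - Theta^2 / 3; the constant 3
    is the trace of the identity. *)
Lemma sqn_shear t : sqn (fun i j => expn i j - t * gb i j) =
  sqn expn - 2 * t * expansion + 3 * t ^+ 2.
Proof.
rewrite !sqn_tr.
have -> : form_mx (fun i j => expn i j - t * gb i j) = form_mx expn - t *: B.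
  by apply/matrixP => i j; rewrite !mxE.
have -> : (form_mx expn - t *: B)^T = form_mx expn - t *: B.
  by apply/matrixP => i j; rewrite !mxE (expnC i j) (gbC i j).
rewrite (form_sym expnC) expansionE trace_up.
rewrite !(mulmxBl, mulmxBr) -!(scalemxAl, scalemxAr).
rewrite -[form_mx expn *m BI *m B]mulmxA mulBBI mulBIB mulmx1 !mul1mx mulBBI.
rewrite !(mxtraceD, mxtraceN, mxtraceZ) mxtrace1 [\tr (BI *m _)]mxtrace_mulC.
by ring.
Qed.

(** The cross terms vanish, being traces of a symmetric against a skew form.  The sign
    of the last term comes from omega_lk = - omega_kl. *)
Lemma trace_Km2 :
  \sum_k \sum_l Km l k * Km k l = sqn expn - N ^+ 4 * sqn vort.
Proof.
transitivity (\tr (BI *m form_mx Kl *m (BI *m form_mx Kl))).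
  rewrite exchange_big; apply: eq_bigr => k _; rewrite -form_mxK mxE.
  by apply: eq_bigr => l _; rewrite !mxE mulrC.
have wT : (form_mx vort)^T = - form_mx vort.
  by apply/matrixP => i j; rewrite !mxE -vort_anti.
have -> : form_mx Kl = form_mx expn + N ^+ 2 *: form_mx vort.
  by apply/matrixP => i j; rewrite !mxE KlE.
rewrite !sqn_tr wT (form_sym expnC) !mulNmx mxtraceN.
have cross : \tr (BI *m form_mx expn *m (BI *m form_mx vort)) = 0.
  apply: half_eq; rewrite addr0 -{1}mxtrace_tr !trmx_mul wT (form_sym expnC).
  rewrite (form_sym gbiC) !mulNmx mxtraceN -mulmxA mxtrace_mulC !mulmxA.
  by rewrite addNr.
move: cross; move: (form_mx expn) (form_mx vort) => T W cross.
rewrite !(mulmxDr, mulmxDl) -!(scalemxAl, scalemxAr) !mxtraceD !mxtraceZ cross.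
rewrite [\tr (BI *m W *m (BI *m T))]mxtrace_mulC cross.
by rewrite [\tr (T *m _ *m _ *m _)]mxtrace_mulC [\tr (W *m _ *m _ *m _)]mxtrace_mulC !mulmxA; ring.
Qed.

(** The cometric is - Phi^-2 xi xi + gbar^ij fr_i fr_j, so that a trace over
    coordinates splits into a vertical and a spatial one. *)
Lemma ric_trace :
  \sum_a \sum_b GI a b * ric (ecoord a) (ecoord b) =
  - NI ^+ 2 * ric e0 e0 + contract (fun i j => ric (fr i) (fr j)).
Proof.
(* The metric dual of dx^b; its xi component is found by pairing with xi. *)
pose g b : vect := \sum_a GI a b *: ecoord a.
have gE b a : g b 0 a = GI a b.
  rewrite /g summxE (bigD1 a) //= big1 => [|c ca]; rewrite scalemxE ecoordE.
    by rewrite eqxx mulr1 addr0.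
  by rewrite eq_sym (negPf ca) mulr0.
have g_vec b : g b = vec (- NI ^+ 2 * (b == 0)%:R) (fun k => GI (es k) b).
  rewrite {1}(vecK (g b)); apply: eq_vec => [|k]; last exact: gE.
  have <- : gg (g b) e0 = (b == 0)%:R.
    rewrite gg_suml.
    transitivity ((G *m GI) 0 b); last by rewrite metricK mxE eq_sym.
    rewrite mxE; apply: eq_bigr => a _.
    by rewrite ggZl gg_coord (metric_sym a 0) mulrC.
  by rewrite {2}(vecK (g b)) gg_vec0; ring: (lapseK S).
have ric_suml (I : finType) (F : I -> vect) Z : ric (\sum_i F i) Z = \sum_i ric (F i) Z.
  apply: (big_morph (ric^~ Z)) => [X Y|]; first exact: ricDl.
  by have := ricZl 0 0 Z; rewrite scale0r mul0r.
transitivity (\sum_b ric (g b) (ecoord b)).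
  rewrite exchange_big; apply: eq_bigr => b _; rewrite ric_suml.
  by apply: eq_bigr => a _; rewrite ricZl.
have step b : ric (g b) (ecoord b) =
    - NI ^+ 2 * (b == 0)%:R * ric e0 (ecoord b) + \sum_k ric (fr k) (GI (es k) b *: ecoord b).
  rewrite {1}g_vec vecE ricDl ricZl ric_suml; congr (_ + _).
  by apply: eq_bigr => k _; rewrite ricZl ricZr.
under eq_bigr do rewrite step.
rewrite big_split; congr (_ + _).
  rewrite (bigD1 0) //= big1 ?addr0 ?mulr1 // => b /negPf ->.
  by rewrite mulr0 mul0r.
have ric_sumr (I : finType) (F : I -> vect) Z : ric Z (\sum_i F i) = \sum_i ric Z (F i).
  by rewrite ricC ric_suml; apply: eq_bigr => i _; rewrite ricC.
(* The remaining sum over b reassembles the dual of dx^k, which has no xi part. *)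
rewrite exchange_big; apply: eq_bigr => k _ /=; rewrite -ric_sumr.
have -> : \sum_b GI (es k) b *: ecoord b = g (es k).
  by apply: eq_bigr => b _; rewrite cometric_sym.
rewrite g_vec vecE mulr0 scale0r add0r ric_sumr; apply: eq_bigr => l _.
by rewrite ricZr gbiE cometric_sym.
Qed.

(** * The Einstein tensor in the adapted frame *)

Definition scal := \sum_a \sum_b GI a b * ric (ecoord a) (ecoord b).
Definition ein X Y := ric X Y - h * scal * gg X Y.
Definition ricbar := locked (fun i j => h * (\sum_k Rb i k j k + \sum_k Rb j k i k)).
Definition div_b := \sum_k hcov_up b_up k k.
Definition b2 := \sum_k acc_b k * b_up k.

Lemma ricbarE i j : ricbar i j = h * (\sum_k Rb i k j k + \sum_k Rb j k i k).
Proof. by rewrite /ricbar -lock. Qed.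

Lemma eq_contract T T' : (forall i j, T i j = T' i j) -> contract T = contract T'.
Proof. by move=> e; do 2![apply: eq_bigr => ? _]; rewrite e. Qed.

Lemma contractD T T' : contract (fun i j => T i j + T' i j) = contract T + contract T'.
Proof.
rewrite -big_split; apply: eq_bigr => i _; rewrite -big_split.
by apply: eq_bigr => j _; rewrite mulrDr.
Qed.

Lemma contractZ f T : contract (fun i j => f * T i j) = f * contract T.
Proof.
rewrite [RHS]mulr_sumr; apply: eq_bigr => i _; rewrite mulr_sumr.
by apply: eq_bigr => j _; rewrite mulrCA.
Qed.

Lemma contract_flip T : contract (fun i j => T j i) = contract T.
Proof.
rewrite [LHS]exchange_big; apply: eq_bigr => i _.
by apply: eq_bigr => j _; rewrite gbiC.
Qed.

Lemma contract_b : contract (fun i j => acc_b i * acc_b j) = b2.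
Proof.
apply: eq_bigr => i _; rewrite mulr_sumr; apply: eq_bigr => j _.
by ring.
Qed.

Lemma contract_expn : contract expn = expansion.
Proof. by rewrite contractE expansionE trace_up. Qed.

Lemma ric_spatial i j : ric (fr i) (fr j) =
  ricbar i j + - h * (hcov_low acc_b i j + hcov_low acc_b j i) + -1 * (acc_b i * acc_b j)
  + NI ^+ 2 * (vcov_low2 expn i j + (expansion - psi) * expn i j).
Proof.
apply: half_eq; rewrite ric_ss_sym !ricbarE.
rewrite -{1}[\sum_k Rb i k j k + _]halfD.
rewrite -{1}[hcov_low acc_b i j + _]halfD.
by ring.
Qed.

Lemma scalE : scal = contract ricbar - 2 * div_b - 2 * b2
  + NI ^+ 2 * (2 * d0 expansion - 2 * psi * expansion + expansion ^+ 2 + sqn expn)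
  - N ^+ 2 * sqn vort.
Proof.
have lin c0 c1 c2 T0 T1 T2 T3 T4 : contract (fun i j =>
    T0 i j + - h * (T1 i j + T1 j i) + c0 * T2 i j + c1 * (T3 i j + c2 * T4 i j)) =
    contract T0 + - h * (contract T1 + contract T1) + c0 * contract T2
    + c1 * (contract T3 + c2 * contract T4).
  by rewrite !(contractD, contractZ) (contract_flip T1).
rewrite /scal ric_trace (eq_contract ric_spatial).
rewrite (lin _ _ _ ricbar (hcov_low acc_b) (fun i j => acc_b i * acc_b j)).
rewrite contract_cov_low -/div_b contract_b contract_cov0_expn.
rewrite contract_expn ric_00 trace_Km2 -/div_b -/b2.
rewrite [- h * _]mulNr [h * (div_b + _)]mulrDr halfD.
by ring: (lapseK S).
Qed.

(** The factor 1/2 of the Einstein tensor is pushed to where it cancels a 2. *)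
Lemma half_scal : h * scal = h * contract ricbar - div_b - b2
  + NI ^+ 2 * (d0 expansion - psi * expansion + h * expansion ^+ 2 + h * sqn expn)
  - h * N ^+ 2 * sqn vort.
Proof.
have half2 x : h * (2 * x) = x by ring: (halfK S).
rewrite scalE -{2}(half2 div_b) -{2}(half2 b2) -{2}(half2 (d0 expansion)).
rewrite -(half2 (psi * expansion)).
by ring.
Qed.

Lemma ein_mixed i : ein e0 (fr i) =
  \sum_k Rb0 i k k + expansion * acc_b i - \sum_k Kl i k * b_up k.
Proof. by rewrite /ein gg_0fr mulr0 subr0 ric_0s. Qed.

Lemma einC X Y : ein X Y = ein Y X.
Proof. by rewrite /ein ricC ggC. Qed.

Lemma ein_expand X Y : ein X Y =
  \sum_a \sum_b X 0 a * Y 0 b * ein (ecoord a) (ecoord b).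
Proof.
have gg_expand : gg X Y = \sum_a \sum_b X 0 a * Y 0 b * gg (ecoord a) (ecoord b).
  rewrite {1}(row_sum_ecoord X) gg_suml; apply: eq_bigr => a _.
  rewrite ggZl ggC {1}(row_sum_ecoord Y) gg_suml mulr_sumr; apply: eq_bigr => b _.
  by rewrite ggZl ggC mulrA.
rewrite /ein ric_expand gg_expand mulr_sumr -sumrB; apply: eq_bigr => a _.
rewrite mulr_sumr -sumrB; apply: eq_bigr => b _.
by ring.
Qed.

Lemma ein_spatial i j : ein (fr i) (fr j) =
  ricbar i j - h * contract ricbar * gb i j
  + (b2 + div_b + h * N ^+ 2 * sqn vort) * gb i j
  - h * (hcov_low acc_b i j + hcov_low acc_b j i) - acc_b i * acc_b j
  + NI ^+ 2 * ((expansion - psi) * expn i j + vcov_low2 expn i j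
    - (d0 expansion - psi * expansion + h * expansion ^+ 2 + h * sqn expn) * gb i j).
Proof.
rewrite /ein ric_spatial half_scal -gbE.
by ring: (lapseK S).
Qed.

Lemma ein_temporal : 2 * ein e0 e0 =
  N ^+ 2 * contract ricbar + expansion ^+ 2 - sqn expn + N ^+ 4 * sqn vort.
Proof.
(* Doubling the Einstein tensor removes the half in front of the scalar curvature. *)
have half2 x y : 2 * (x - h * y * - N ^+ 2) = 2 * x + N ^+ 2 * y.
  by ring: (halfK S).
rewrite /ein gg00 half2 scalE ric_00 trace_Km2 -/div_b -/b2.
by ring: (lapseK S).
Qed.

End Algebra.

(** * Smooth functions on an open set *)

(** Differentiability is local: the same differential serves for both functions. *)
Lemma near_eq_differentiable (R : realType) (V W : normedModType R) (f g : V -> W) x :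
  (\forall y \near x, f y = g y) -> differentiable f x -> differentiable g x.
Proof.
move=> fg df.
have c : continuous ('d f x) by apply: diff_continuous.
have e : g \o shift x = cst (g x) + 'd f x +o_ 0 id.
  have df' := diff_locally df.
  apply/eqaddoP => eps eps0; move/eqaddoP/(_ eps eps0): df'.
  have fgx := nbhs_singleton fg.
  have : \forall h \near (0 : V), f (h + x) = g (h + x).
    by move: fg; rewrite (near_shift 0 x) /= subr0.
  apply: filterS2 => h /= fgh.
  rewrite /= /cst -![(_ + _ : V -> W) _]/(_ + _) -![(- _ : V -> W) _]/(- _).
  by rewrite -![(_ + _ : V -> W) _]/(_ + _) /= fgh fgx.
have gf := diff_unique c e.
by apply/diff_locallyP; rewrite gf.
Qed.

Section Smooth.
Context {R : realType}.
Local Notation point := 'rV[R]_4.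
Implicit Types (D : set point) (f g : point -> R) (x y : point).

(** Where f is differentiable, the directional derivative is linear in the direction. *)
Lemma alongE (X : point -> point) f x : differentiable f x ->
  along X f x = \sum_a X x 0 a * partial a f x.
Proof.
move=> df; rewrite /partial /along deriveE // {1}[X x]row_sum_delta linear_sum.
by apply: eq_bigr => a _; rewrite linearZ /= deriveE.
Qed.

Lemma near_eq_along D f g (X : point -> point) x : open D -> D x ->
  (forall y, D y -> f y = g y) -> along X f x = along X g x.
Proof.
move=> oD Dx fg; apply: near_eq_derive.
have : nbhs x D by apply: open_nbhs_nbhs.
exact: filterS.
Qed.

(** Bounding the order of differentiation makes closure properties provable by induction
    on the order, with the Leibniz rule in the step; see [smooth_onP]. *)
Fixpoint smooth_upto n D f : Prop :=
  (forall x, D x -> differentiable f x) /\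
  if n is n'.+1 then forall a, smooth_upto n' D (partial a f) else True.

Lemma smooth_onP D f : smooth_on D f <-> forall n, smooth_upto n D f.
Proof.
split=> [sf n|sf s].
  elim: n f sf => [|n IH] f sf; first by split=> // x Dx; exact: (sf [::]).
  split=> [x Dx|a]; first exact: (sf [::]).
  by apply: IH => s x Dx; rewrite -foldr_rcons; exact: sf.
elim/last_ind: s f sf => [|s a IH] f sf x Dx /=; first by have [df _] := sf 0%N; exact: df.
by rewrite foldr_rcons; apply: IH => // n; have [_ sfa] := sf n.+1; exact: sfa.
Qed.

Lemma smooth_partial D f a : smooth_on D f -> smooth_on D (partial a f).
Proof. by move=> sf s x Dx; rewrite -foldr_rcons; exact: sf. Qed.

Lemma smooth_diff D f x : smooth_on D f -> D x -> differentiable f x.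
Proof. by move=> sf; exact: (sf [::]). Qed.

Lemma smooth_uptoW n D f : smooth_upto n.+1 D f -> smooth_upto n D f.
Proof.
by elim: n f => [|n IH] f [df sf]; split=> // a; apply: IH; exact: sf.
Qed.

Lemma smooth_upto_eq n D f g : open D -> (forall x, D x -> f x = g x) ->
  smooth_upto n D f -> smooth_upto n D g.
Proof.
move=> oD; elim: n f g => [|n IH] f g fg [df sf].
  split=> // x Dx; apply: near_eq_differentiable (df x Dx).
  have : nbhs x D by apply: open_nbhs_nbhs.
  exact: filterS.
split=> [x Dx|a].
  apply: near_eq_differentiable (df x Dx).
  have : nbhs x D by apply: open_nbhs_nbhs.
  exact: filterS.
by apply: IH (sf a) => x Dx; exact: near_eq_along oD Dx fg.
Qed.

Lemma smooth_eq D f g : open D -> (forall x, D x -> f x = g x) ->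
  smooth_on D f -> smooth_on D g.
Proof.
by move=> oD fg /smooth_onP sf; apply/smooth_onP => n; exact: smooth_upto_eq (sf n).
Qed.

Lemma partialD a f g x : differentiable f x -> differentiable g x ->
  partial a (fun y => f y + g y) x = partial a f x + partial a g x.
Proof. by move=> df dg; apply: deriveD; exact: diff_derivable. Qed.

Lemma partialM a f g x : differentiable f x -> differentiable g x ->
  partial a (fun y => f y * g y) x = partial a f x * g x + f x * partial a g x.
Proof.
move=> df dg; rewrite addrC [_ * g x]mulrC.
by apply: deriveM; exact: diff_derivable.
Qed.

Lemma partialV a f x : differentiable f x -> f x != 0 ->
  partial a (fun y => (f y)^-1) x = - ((f x)^-1 * (f x)^-1 * partial a f x).
Proof.
move=> df f0; rewrite /partial /along deriveV //; last exact: diff_derivable.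
by rewrite -expr2 exprVn -mulNr.
Qed.

Lemma partial_cst a (c : R) x : partial a (fun=> c) x = 0.
Proof. exact: derive_cst. Qed.

Lemma smooth_upto_cst n D c : open D -> smooth_upto n D (fun=> c).
Proof.
move=> oD; elim: n c => [|n IH] c; first by split=> // x _; exact: differentiable_cst.
split=> [x _|a]; first exact: differentiable_cst.
by apply: smooth_upto_eq (IH 0) => // x Dx; rewrite partial_cst.
Qed.

Lemma smooth_uptoD n D f g : open D ->
  smooth_upto n D f -> smooth_upto n D g -> smooth_upto n D (fun x => f x + g x).
Proof.
move=> oD; elim: n f g => [|n IH] f g [df sf] [dg sg].
  by split=> // x Dx; apply: differentiableD; [exact: df|exact: dg].
split=> [x Dx|a]; first by apply: differentiableD; [exact: df|exact: dg].
apply: (smooth_upto_eq (f := fun x => partial a f x + partial a g x)) => // [x Dx|].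
  by rewrite partialD; [|exact: df|exact: dg].
by apply: IH; [exact: sf|exact: sg].
Qed.

Lemma smooth_uptoM n D f g : open D ->
  smooth_upto n D f -> smooth_upto n D g -> smooth_upto n D (fun x => f x * g x).
Proof.
move=> oD; elim: n f g => [|n IH] f g.
  by move=> [df _] [dg _]; split=> // x Dx; apply: differentiableM; [exact: df|exact: dg].
move=> Sf Sg; have [df sf] := Sf; have [dg sg] := Sg.
split=> [x Dx|a]; first by apply: differentiableM; [exact: df|exact: dg].
apply: (smooth_upto_eq (f := fun x => partial a f x * g x + f x * partial a g x)) => // [x Dx|].
  by rewrite partialM; [|exact: df|exact: dg].
apply: smooth_uptoD => //; apply: IH; [exact: sf| | |exact: sg].
- exact: smooth_uptoW Sg.
- exact: smooth_uptoW Sf.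
Qed.

(** One order less for 1/f is available by induction, and the derivative of 1/f is a
    product of 1/f twice and a derivative of f. *)
Lemma smooth_uptoV n D f : open D -> (forall x, D x -> f x != 0) ->
  smooth_upto n D f -> smooth_upto n D (fun x => (f x)^-1).
Proof.
move=> oD f0; elim: n => [|n IH] Sf; have [df sf] := Sf.
  by split=> // x Dx; apply: differentiableV; [exact: df|exact: f0].
have sV : smooth_upto n D (fun x => (f x)^-1) by apply: IH; exact: smooth_uptoW.
split=> [x Dx|a]; first by apply: differentiableV; [exact: df|exact: f0].
apply: (smooth_upto_eq (f := fun x => -1 * ((f x)^-1 * (f x)^-1 * partial a f x))) => //.
  by move=> x Dx; rewrite partialV ?mulN1r; [|exact: df|exact: f0].
apply: (smooth_uptoM (f := fun=> -1)) => //; first exact: smooth_upto_cst.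
have sV2 := smooth_uptoM oD sV sV.
exact: (smooth_uptoM oD sV2 (sf a)).
Qed.

Lemma line_derive f (v y : point) (s : R) : differentiable f (s *: v + y) ->
  is_derive s 1 (fun t => f (t *: v + y)) ('D_v f (s *: v + y)).
Proof.
move=> /(@diff_derivable _ _ _ _ _ v) df.
have e : (fun h : R => h^-1 *: (((fun t => f (t *: v + y)) \o shift s) (h *: 1)
             - f (s *: v + y))) =
    (fun h => h^-1 *: ((f \o shift (s *: v + y)) (h *: v) - f (s *: v + y))).
  by apply/funext => t /=; rewrite scalerDl addrA [_ *: 1]mulr1.
by split; rewrite /derivable /derive e.
Qed.

(** The mean value theorem applied twice: first in the direction v to the difference of
    two translates of f, then in the direction w to the derivative of f along v. *)
Lemma second_difference D f (v w x : point) (r : R) : open D -> 0 <= r ->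
  (forall y, D y -> differentiable f y) ->
  (forall y, D y -> differentiable (fun z => 'D_v f z) y) ->
  (forall s t, 0 <= s <= r -> 0 <= t <= r -> D (t *: w + (s *: v + x))) ->
  exists s t, [/\ 0 <= s <= r, 0 <= t <= r &
    f (r *: v + (r *: w + x)) - f (r *: v + x) - (f (r *: w + x) - f x)
    = 'D_w (fun z => 'D_v f z) (t *: w + (s *: v + x)) * r * r].
Proof.
move=> oD r0 df ddf inD.
pose phi (s : R) := f (s *: v + (r *: w + x)) - f (s *: v + x).
pose dphi (s : R) := 'D_v f (s *: v + (r *: w + x)) - 'D_v f (s *: v + x).
have r0r : 0 <= r <= r by rewrite r0 lexx.
have z0r : 0 <= (0 : R) <= r by rewrite r0 lexx.
have Dw s : 0 <= s <= r -> D (s *: v + (r *: w + x)).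
  by move=> sr; rewrite addrCA; exact: inD.
have D0 s : 0 <= s <= r -> D (s *: v + x).
  by move=> sr; rewrite -[s *: v + x]add0r -(scale0r w); exact: inD.
have phiD s : 0 <= s <= r -> is_derive s 1 phi (dphi s).
  move=> sr; apply: is_deriveB; apply: line_derive; apply: df; first exact: Dw.
  exact: D0.
have contphi : {within `[0, r], continuous phi}.
  apply: derivable_within_continuous => s; rewrite in_itv /= => sr.
  by have [] := phiD s sr.
have itv s : s \in `]0, r[ -> 0 <= s <= r by move=> /andP[? ?]; apply/andP; split; apply: ltW.
have [s sr phiE] := MVT_segment r0 (fun s sr => phiD s (itv s sr)) contphi.
rewrite in_itv /= in sr.
pose psi (t : R) := 'D_v f (t *: w + (s *: v + x)).
pose dpsi (t : R) := 'D_w (fun z => 'D_v f z) (t *: w + (s *: v + x)).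
have psiD t : 0 <= t <= r -> is_derive t 1 psi (dpsi t).
  by move=> tr; apply: (@line_derive (fun z => 'D_v f z)); apply: ddf; exact: inD.
have contpsi : {within `[0, r], continuous psi}.
  apply: derivable_within_continuous => t; rewrite in_itv /= => tr.
  by have [] := psiD t tr.
have [t tr psiE] := MVT_segment r0 (fun t tr => psiD t (itv t tr)) contpsi.
rewrite in_itv /= in tr.
exists s, t; split=> //.
have -> : f (r *: v + (r *: w + x)) - f (r *: v + x) - (f (r *: w + x) - f x) =
    phi r - phi 0 by rewrite /phi !scale0r !add0r.
rewrite phiE subr0; congr (_ * r).
have -> : dphi s = psi r - psi 0 by rewrite /dphi /psi scale0r add0r addrCA.
by rewrite psiE subr0.
Qed.

(** The second difference of f is symmetric in v and w.  Computed in the two possible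
    orders, it equals r^2 times a mixed derivative at a point near x, and continuity at
    x identifies the limits. *)
Lemma schwarz D f (v w x : point) : open D -> D x ->
  (forall y, D y -> differentiable f y) ->
  (forall y, D y -> differentiable (fun z => 'D_v f z) y) ->
  (forall y, D y -> differentiable (fun z => 'D_w f z) y) ->
  {for x, continuous (fun z => 'D_w (fun z => 'D_v f z) z)} ->
  {for x, continuous (fun z => 'D_v (fun z => 'D_w f z) z)} ->
  'D_w (fun z => 'D_v f z) x = 'D_v (fun z => 'D_w f z) x.
Proof.
move=> oD Dx df dvf dwf.
pose P : point -> R := fun z => 'D_w (fun z => 'D_v f z) z.
pose Q : point -> R := fun z => 'D_v (fun z => 'D_w f z) z.
move=> cP cQ; rewrite -/(P x) -/(Q x).
apply/eqP; rewrite -subr_eq0 -normr_le0; apply/ler_addgt0Pr => e e0; rewrite add0r.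
have e2 : 0 < e / 2 by rewrite divr_gt0.
pose U : set point := fun t => `|P x - P t| < e / 2.
pose V : set point := fun t => `|Q x - Q t| < e / 2.
have nD : nbhs x D by apply: open_nbhs_nbhs.
have nU : nbhs x U by apply: (cvgr_dist_lt P (P x) cP).
have nV : nbhs x V by apply: (cvgr_dist_lt Q (Q x) cQ).
have nDUV : nbhs x (D `&` (U `&` V)) by apply: filterI => //; exact: filterI.
have /nbhs_ballP[d /= d0 sub] := nDUV.
have near_x z : ball x d z -> [/\ D z, `|P x - P z| < e / 2 & `|Q x - Q z| < e / 2].
  by move=> bz; have [Dz [Uz Vz]] := sub z bz; exact: And3 Dz Uz Vz.
(* Every point x + s v + t w with s and t at most r lies within r M = d / 2 of x;
   the 1 keeps M positive when both directions vanish. *)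
pose M := `|v| + `|w| + 1.
have M0 : 0 < M by rewrite ltr_wpDl // addr_ge0.
pose r := d / (2 * M).
have r0 : 0 < r by rewrite divr_gt0 // mulr_gt0.
have small (a b : point) s t : `|a| + `|b| + 1 = M -> 0 <= s <= r -> 0 <= t <= r ->
    ball x d (t *: b + (s *: a + x)).
  move=> abM /andP[s0 sr] /andP[t0 tr].
  rewrite -ball_normE /= addrA opprD addrCA subrr addr0 normrN.
  apply: (le_lt_trans (ler_normD _ _)); rewrite !normrZ !ger0_norm //.
  apply: (@le_lt_trans _ _ (r * M)).
    rewrite -abM !mulrDr; have := ler_wpM2r (normr_ge0 a) sr.
    by have := ler_wpM2r (normr_ge0 b) tr; lra.
  by rewrite /r invfM mulrA mulfVK ?gt_eqF //; lra.
have swapM : `|w| + `|v| + 1 = M by rewrite /M [`|w| + _]addrC.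
have [] := @second_difference D f v w x r oD (ltW r0) df dvf.
  by move=> s t sr tr; have [] := near_x _ (small v w s t erefl sr tr).
move=> s [t [sr tr Pst]].
have [] := @second_difference D f w v x r oD (ltW r0) df dwf.
  by move=> s' t' sr' tr'; have [] := near_x _ (small w v s' t' swapM sr' tr').
move=> s' [t' [sr' tr' Qst]].
have e12 : f (r *: v + (r *: w + x)) - f (r *: v + x) - (f (r *: w + x) - f x)
    = f (r *: w + (r *: v + x)) - f (r *: w + x) - (f (r *: v + x) - f x).
  rewrite [r *: v + (r *: w + x)]addrCA.
  move: (f (r *: w + (r *: v + x))) (f (r *: v + x)) (f (r *: w + x)) (f x) => f1 f2 f3 f4.
  by ring.
have PQr : P (t *: w + (s *: v + x)) * r * r = Q (t' *: v + (s' *: w + x)) * r * r.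
  exact: etrans (esym Pst) (etrans e12 Qst).
have [_ Pz _] := near_x _ (small v w s t erefl sr tr).
have [_ _ Qz] := near_x _ (small w v s' t' swapM sr' tr').
move: Pz Qz PQr; move: (P (t *: w + _)) (P x) (Q (t' *: v + _)) (Q x) => p px q qx pz qz.
move=> /(mulIf (lt0r_neq0 r0)) /(mulIf (lt0r_neq0 r0)) pq; rewrite {}pq in pz.
have -> : px - qx = (px - q) - (qx - q) by ring.
apply: le_trans (ler_normB _ _) _; rewrite [leRHS]splitr.
exact: lerD (ltW pz) (ltW qz).
Qed.

Lemma partialC D f a b x : open D -> D x -> smooth_on D f ->
  partial a (partial b f) x = partial b (partial a f) x.
Proof.
move=> oD Dx sf; rewrite /partial /along /=.
have sp c := smooth_partial c sf; have spp c d := smooth_partial d (sp c).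
apply: (schwarz oD Dx) => [y Dy|y Dy|y Dy||].
- exact: smooth_diff sf Dy.
- exact: smooth_diff (sp _) Dy.
- exact: smooth_diff (sp _) Dy.
- exact: differentiable_continuous (smooth_diff (spp _ _) Dx).
- exact: differentiable_continuous (smooth_diff (spp _ _) Dx).
Qed.

End Smooth.

(** * The differential ring of smooth functions on an open set *)

Section SmoothClosure.
Context {R : realType} (D : set 'rV[R]_4) (oD : open D).
Implicit Types f g : 'rV[R]_4 -> R.

Lemma smooth_cst (c : R) : smooth_on D (fun=> c).
Proof. by apply/smooth_onP => n; exact: smooth_upto_cst. Qed.

Lemma smoothD f g : smooth_on D f -> smooth_on D g -> smooth_on D (fun x => f x + g x).
Proof.
by move=> /smooth_onP sf /smooth_onP sg; apply/smooth_onP => n; exact: smooth_uptoD.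
Qed.

Lemma smoothM f g : smooth_on D f -> smooth_on D g -> smooth_on D (fun x => f x * g x).
Proof.
by move=> /smooth_onP sf /smooth_onP sg; apply/smooth_onP => n; exact: smooth_uptoM.
Qed.

Lemma smoothV f : (forall x, D x -> f x != 0) ->
  smooth_on D f -> smooth_on D (fun x => (f x)^-1).
Proof. by move=> f0 /smooth_onP sf; apply/smooth_onP => n; exact: smooth_uptoV. Qed.

Lemma smoothN f : smooth_on D f -> smooth_on D (fun x => - f x).
Proof.
move=> sf; apply: smooth_eq oD _ (smoothM (smooth_cst (-1)) sf) => x _.
by rewrite mulN1r.
Qed.

End SmoothClosure.

(** Smooth functions on D, extended by zero outside D.  The normalization makes
    equality on D the equality of the ring. *)
Record sfun (R : realType) (D : set 'rV[R]_4) (oD : open D) := SFun {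
  sval :> 'rV[R]_4 -> R;
  sval_smooth : smooth_on D sval;
  sval_out : forall x, ~ D x -> sval x = 0
}.

Section SmoothRing.
Context {R : realType} (D : set 'rV[R]_4) (oD : open D).
Local Notation A := (sfun oD).
Implicit Types (f g : 'rV[R]_4 -> R) (F G H : A).

Lemma sfunP F G : (forall x, D x -> F x = G x) -> F = G.
Proof.
case: F G => [f sf f0] [g sg g0] /= fg.
have e : f = g.
  by apply/funext => x; have [Dx|nDx] := pselect (D x); [exact: fg|rewrite f0 ?g0].
by move: sf f0; rewrite e => sf f0; congr (SFun oD); exact: Prop_irrelevance.
Qed.

(** Extension by zero from D; as D is open this does not affect smoothness on D. *)
Definition restr f x : R := if pselect (D x) then f x else 0.

Lemma restr_in f x : D x -> restr f x = f x.
Proof. by rewrite /restr; case: pselect. Qed.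

Lemma restr_smooth f : smooth_on D f -> smooth_on D (restr f).
Proof. by move=> sf; apply: smooth_eq oD _ sf => x Dx; rewrite restr_in. Qed.

Lemma restr_out f x : ~ D x -> restr f x = 0.
Proof. by rewrite /restr; case: pselect. Qed.

Definition mks f (sf : smooth_on D f) : A := SFun oD (restr_smooth sf) (restr_out f).

Lemma mksE f (sf : smooth_on D f) x : D x -> mks sf x = f x.
Proof. exact: restr_in. Qed.

Definition addS F G : A := mks (smoothD oD (sval_smooth F) (sval_smooth G)).
Definition mulS F G : A := mks (smoothM oD (sval_smooth F) (sval_smooth G)).
Definition oppS F : A := mks (smoothN oD (sval_smooth F)).
Definition cstS (c : R) : A := mks (smooth_cst oD c).
Definition pdS a F : A := mks (smooth_partial a (sval_smooth F)).

HB.instance Definition _ := gen_eqMixin A.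
HB.instance Definition _ := gen_choiceMixin A.

Let addSA : associative addS.
Proof. by move=> F G H; apply: sfunP => x Dx; rewrite !mksE // addrA. Qed.
Let addSC : commutative addS.
Proof. by move=> F G; apply: sfunP => x Dx; rewrite !mksE // addrC. Qed.
Let add0S : left_id (cstS 0) addS.
Proof. by move=> F; apply: sfunP => x Dx; rewrite !mksE // add0r. Qed.
Let addNS : left_inverse (cstS 0) oppS addS.
Proof. by move=> F; apply: sfunP => x Dx; rewrite !mksE // addNr. Qed.

HB.instance Definition _ := GRing.isZmodule.Build A addSA addSC add0S addNS.

Let mulSA : associative mulS.
Proof. by move=> F G H; apply: sfunP => x Dx; rewrite !mksE // mulrA. Qed.
Let mulSC : commutative mulS.
Proof. by move=> F G; apply: sfunP => x Dx; rewrite !mksE // mulrC. Qed.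
Let mul1S : left_id (cstS 1) mulS.
Proof. by move=> F; apply: sfunP => x Dx; rewrite !mksE // mul1r. Qed.
Let mulSDl : left_distributive mulS addS.
Proof. by move=> F G H; apply: sfunP => x Dx; rewrite !mksE // mulrDl. Qed.

HB.instance Definition _ := GRing.Zmodule_isComPzRing.Build A mulSA mulSC mul1S mulSDl.

(** A ring morphism, for each point of D; jointly these separate elements ([ev_inj]). *)
Definition ev x (Dx : D x) (F : A) : R := F x.

Section Eval.
Context x (Dx : D x).

Let ev_sub : {morph ev Dx : F G / F - G}.
Proof. by move=> F G; rewrite /ev !mksE. Qed.
Let ev_mul : monoid_morphism (ev Dx).
Proof. by split=> [|F G]; rewrite /ev !mksE. Qed.

HB.instance Definition _ := GRing.isZmodMorphism.Build A R (ev Dx) ev_sub.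
HB.instance Definition _ := GRing.isMonoidMorphism.Build A R (ev Dx) ev_mul.

End Eval.

Section EvalTheory.
Context x (Dx : D x).

Lemma evD F G : ev Dx (F + G) = ev Dx F + ev Dx G. Proof. exact: rmorphD. Qed.
Lemma evN F : ev Dx (- F) = - ev Dx F. Proof. exact: rmorphN. Qed.
Lemma evB F G : ev Dx (F - G) = ev Dx F - ev Dx G. Proof. exact: rmorphB. Qed.
Lemma evM F G : ev Dx (F * G) = ev Dx F * ev Dx G. Proof. exact: rmorphM. Qed.
Lemma ev1 : ev Dx 1 = 1. Proof. exact: rmorph1. Qed.
Lemma ev_nat n : ev Dx n%:R = n%:R. Proof. exact: rmorph_nat. Qed.
Lemma evX F n : ev Dx (F ^+ n) = ev Dx F ^+ n. Proof. exact: rmorphXn. Qed.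
Lemma ev_sum (I : finType) (E : I -> A) : ev Dx (\sum_i E i) = \sum_i ev Dx (E i).
Proof. exact: rmorph_sum. Qed.

End EvalTheory.

Lemma pdSD a F G : pdS a (F + G) = pdS a F + pdS a G.
Proof.
apply: sfunP => x Dx; rewrite !mksE //.
rewrite -partialD; [|exact: smooth_diff (sval_smooth _) Dx..].
by apply: near_eq_along oD Dx _ => y Dy; rewrite mksE.
Qed.

Lemma pdSM a F G : pdS a (F * G) = pdS a F * G + F * pdS a G.
Proof.
apply: sfunP => x Dx; rewrite !mksE //.
rewrite -partialM; [|exact: smooth_diff (sval_smooth _) Dx..].
by apply: near_eq_along oD Dx _ => y Dy; rewrite mksE.
Qed.

Lemma pdSE a F x : D x -> pdS a F x = partial a F x.
Proof. exact: mksE. Qed.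

(** Here the symmetry of second derivatives enters. *)
Lemma pdSC a b F : pdS a (pdS b F) = pdS b (pdS a F).
Proof.
apply: sfunP => x Dx.
have e c d : pdS c (pdS d F) x = partial c (partial d F) x.
  by rewrite pdSE //; apply: near_eq_along oD Dx _ => y Dy; exact: pdSE.
rewrite [LHS]e [RHS]e; exact: partialC oD Dx (sval_smooth F).
Qed.

(** Fields are arbitrary functions outside D, so they are related to ring elements by
    agreement on D; derivatives respect this because D is open. *)
Definition repr f F := forall x (Dx : D x), f x = ev Dx F.

Lemma repr_mks f (sf : smooth_on D f) : repr f (mks sf).
Proof. by move=> x Dx; rewrite /ev mksE. Qed.

Lemma ev_mks f (sf : smooth_on D f) x (Dx : D x) : ev Dx (mks sf) = f x.
Proof. by rewrite -repr_mks. Qed.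

Lemma repr_partial a f F : repr f F -> repr (partial a f) (pdS a F).
Proof.
move=> fF x Dx; rewrite /ev mksE //; apply: near_eq_along oD Dx _ => y Dy.
exact: fF.
Qed.

Lemma repr_smooth f F : repr f F -> smooth_on D f.
Proof. by move=> fF; apply: smooth_eq oD _ (sval_smooth F) => x Dx; rewrite (fF x Dx). Qed.

Lemma ev_inj F G : (forall x (Dx : D x), ev Dx F = ev Dx G) -> F = G.
Proof. exact: sfunP. Qed.

End SmoothRing.

Arguments ev {R D oD x} Dx F : simpl never.

(** * The algebraic model of a threaded spacetime *)

Section Model.
Context {R : realType} (D : set 'rV[R]_4) (oD : open D).
Context (g : 'rV[R]_4 -> 'M[R]_4) (Phi : 'rV[R]_4 -> R).
Local Notation A := (sfun oD).

(** What the model uses of g and Phi; a Lorentz metric enters as a nondegenerate one. *)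
Record threaded_metric := ThreadedMetric {
  g_smooth : smooth_mx_on D g;
  g_sym : forall x, D x -> (g x)^T = g x;
  g_unit : forall x, D x -> g x \in unitmx;
  Phi_smooth : smooth_on D Phi;
  Phi_neq0 : forall x, D x -> Phi x != 0;
  g_xi_xi : forall x, D x -> g x 0 0 = - Phi x ^+ 2
}.

Context (H : threaded_metric).

(** The inverse metric is the adjugate divided by the determinant, which keeps its entries
    in the ring. *)
Definition metricA : 'M[A]_4 := \matrix_(a, b) mks oD (g_smooth H a b).

Lemma ev_metricA x (Dx : D x) : map_mx (ev Dx) metricA = g x.
Proof. by apply/matrixP => a b; rewrite !mxE ev_mks. Qed.

Lemma ev_det x (Dx : D x) : ev Dx (\det metricA) = \det (g x).
Proof. by rewrite -det_map_mx ev_metricA. Qed.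

Lemma det_neq0 x : D x -> (\det metricA : A) x != 0.
Proof.
by move=> Dx; rewrite -[_ x]/(ev Dx _) ev_det -unitfE -unitmxE; exact: (g_unit H).
Qed.

Definition detI : A := mks oD (smoothV oD det_neq0 (sval_smooth (\det metricA))).

Definition lapseA : A := mks oD (Phi_smooth H).
Definition lapseIA : A := mks oD (smoothV oD (Phi_neq0 H) (Phi_smooth H)).

Fact metricA_sym : metricA^T = metricA.
Proof.
apply/matrixP => a b; rewrite !mxE; apply: ev_inj => x Dx; rewrite !ev_mks.
by rewrite -[in LHS](g_sym H Dx) mxE.
Qed.

Fact metricA_inv : metricA *m (detI *: \adj metricA) = 1%:M.
Proof.
rewrite -scalemxAr mul_mx_adj scale_scalar_mx; congr (_%:M).
apply: ev_inj => x Dx; rewrite evM ev1 /detI ev_mks.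
by rewrite mulVf //; exact: det_neq0.
Qed.

Fact lapseA_inv : lapseA * lapseIA = 1.
Proof.
apply: ev_inj => x Dx; rewrite evM ev1 /lapseA /lapseIA !ev_mks.
by rewrite divff //; exact: (Phi_neq0 H).
Qed.

Fact metricA00 : metricA 0 0 = - lapseA ^+ 2.
Proof.
apply: ev_inj => x Dx; rewrite evN evX mxE /lapseA !ev_mks.
exact: (g_xi_xi H).
Qed.

Fact halfA_inv : 2 * cstS oD 2^-1 = 1.
Proof.
apply: ev_inj => x Dx; rewrite evM ev1 ev_nat /cstS ev_mks.
by rewrite divff // pnatr_eq0.
Qed.

Definition model : spacetime A := @Spacetime A (@pdS _ _ oD) (@pdSD _ _ oD) (@pdSM _ _ oD)
  (@pdSC _ _ oD) metricA (detI *: \adj metricA) metricA_sym metricA_inv lapseA lapseIA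
  lapseA_inv metricA00 (cstS oD 2^-1) halfA_inv.

Local Notation S := model.
Local Notation point := 'rV[R]_4.
Implicit Types (f : point -> R) (F : A) (X Y Z : point -> point) (XA YA ZA : 'rV[A]_4).

Lemma ev_half x (Dx : D x) : ev Dx (half S) = 2^-1.
Proof. exact: ev_mks. Qed.

Lemma ev_lapse x (Dx : D x) : ev Dx (lapse S) = Phi x.
Proof. exact: ev_mks. Qed.

Lemma ev_lapseI x (Dx : D x) : ev Dx (lapseI S) = (Phi x)^-1.
Proof. exact: ev_mks. Qed.

Lemma ev_cometric x (Dx : D x) a b : ev Dx (cometric S a b) = invmx (g x) a b.
Proof.
have e : map_mx (ev Dx) (cometric S) = invmx (g x).
  rewrite -[LHS]mul1mx -(mulVmx (g_unit H Dx)) -mulmxA -[in g x *m _](ev_metricA Dx).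
  by rewrite -map_mxM (metricK S) map_mx1 mulmx1.
by rewrite -e [RHS]mxE.
Qed.

Definition reprV X XA := forall c, repr (fun x => X x 0 c) (XA 0 c).

Lemma repr_along X XA f F : reprV X XA -> repr f F -> repr (along X f) (dirder S XA F).
Proof.
move=> XXA fF x Dx; rewrite dirderE ev_sum.
have -> : along X f x = along X F x by apply: near_eq_along oD Dx _ => y Dy; exact: fF.
rewrite alongE; last exact: smooth_diff (sval_smooth F) Dx.
by apply: eq_bigr => a _; rewrite evM -XXA; congr (_ * _); symmetry; exact: pdSE.
Qed.

Lemma reprV_coord a : reprV (coord_field a) (ecoord a).
Proof. by move=> c x Dx; rewrite ecoordE ev_nat mxE eqxx. Qed.

Lemma invmx_sym x (Dx : D x) a b : invmx (g x) a b = invmx (g x) b a.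
Proof. by rewrite -(ev_cometric Dx) cometric_sym ev_cometric. Qed.

Lemma ev_christoffel x (Dx : D x) a b c :
  ev Dx (christoffel_mx S a b c) = christoffel g c a b x.
Proof.
have pdE i j k : ev Dx (pd S i (metric S j k)) = partial i (fun y => g y j k) x.
  have gjk : repr (fun y => g y j k) (metric S j k) by move=> y Dy; rewrite mxE ev_mks.
  by symmetry; exact: repr_partial gjk x Dx.
rewrite [in LHS]mxE ev_sum /christoffel mulr_sumr; apply: eq_bigr => d _.
by rewrite [in LHS]mxE !evM ev_half evB evD !pdE ev_cometric (invmx_sym Dx d c); ring.
Qed.

Lemma reprV_nabla X Y XA YA : reprV X XA -> reprV Y YA ->
  reprV (nabla g X Y) (conn S XA YA).
Proof.
move=> rX rY c x Dx; rewrite mxE connE evD; congr (_ + _).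
  exact: (repr_along rX (rY c) Dx).
rewrite ev_sum; apply: eq_bigr => a _; rewrite evM -rX.
rewrite ev_sum mulr_sumr; apply: eq_bigr => b _; rewrite evM -rY ev_christoffel.
by ring.
Qed.

Lemma reprV_bracket X Y XA YA : reprV X XA -> reprV Y YA ->
  reprV (lie_bracket X Y) (bracket S XA YA).
Proof.
move=> rX rY c x Dx; rewrite mxE bracketE evB.
by congr (_ - _); [exact: (repr_along rX (rY c) Dx)|exact: (repr_along rY (rX c) Dx)].
Qed.

(** Stated for an arbitrary connection, to serve for both the spacetime and the spatial
    curvature. *)
Lemma reprV_curvature (nab : (point -> point) -> (point -> point) -> point -> point)
    (nabA : 'rV[A]_4 -> 'rV[A]_4 -> 'rV[A]_4) X Y Z XA YA ZA :
  (forall X Y XA YA, reprV X XA -> reprV Y YA -> reprV (nab X Y) (nabA XA YA)) ->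
  reprV X XA -> reprV Y YA -> reprV Z ZA ->
  reprV (curvature nab X Y Z)
    (nabA XA (nabA YA ZA) - nabA YA (nabA XA ZA) - nabA (bracket S XA YA) ZA).
Proof.
move=> rn rX rY rZ c x Dx; rewrite /curvature !addmxE !oppmxE !evB.
have rB := reprV_bracket rX rY.
by rewrite (rn _ _ _ _ rX (rn _ _ _ _ rY rZ)) (rn _ _ _ _ rY (rn _ _ _ _ rX rZ))
  (rn _ _ _ _ rB rZ).
Qed.

Lemma repr_bilin X Y XA YA : reprV X XA -> reprV Y YA -> repr (bilin g X Y) (gg S XA YA).
Proof.
move=> rX rY x Dx; rewrite ggE.
have evV Z ZA : reprV Z ZA -> map_mx (ev Dx) ZA = Z x.
  by move=> rZ; apply/rowP => c; rewrite mxE -rZ.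
transitivity (map_mx (ev Dx) (XA *m metric S *m YA^T) 0 0); last by rewrite [LHS]mxE.
by rewrite !map_mxM -matrix.map_trmx (evV _ _ rX) (evV _ _ rY) ev_metricA.
Qed.

Lemma repr_ricci X Y XA YA : reprV X XA -> reprV Y YA -> repr (ricci g X Y) (ric S XA YA).
Proof.
move=> rX rY x Dx; rewrite ricE ev_sum; apply: eq_bigr => c _; rewrite riemE.
exact: (reprV_curvature reprV_nabla (reprV_coord c) rX rY).
Qed.

Lemma repr_scalar : repr (scalar_curvature g) (scal S).
Proof.
move=> x Dx; rewrite /scal ev_sum; apply: eq_bigr => a _; rewrite ev_sum.
apply: eq_bigr => b _; rewrite evM ev_cometric; congr (_ * _).
exact: (repr_ricci (reprV_coord a) (reprV_coord b)).
Qed.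

Lemma repr_einstein X Y XA YA : reprV X XA -> reprV Y YA ->
  repr (einstein_tensor g X Y) (ein S XA YA).
Proof.
move=> rX rY x Dx; rewrite /ein evB !evM ev_half -(repr_ricci rX rY) -repr_scalar.
by rewrite -(repr_bilin rX rY).
Qed.

(** * Spatial quantities *)

Lemma reprV_xi : reprV xi (ecoord 0).
Proof. exact: reprV_coord. Qed.

Lemma repr_A i : repr (A_ g Phi i) (slope S i).
Proof.
move=> x Dx; rewrite slopeE evN evM evX ev_lapseI /A_ -gg_coord.
by rewrite -(repr_bilin (reprV_coord _) reprV_xi) exprVn.
Qed.

Lemma reprV_delta i : reprV (delta g Phi i) (fr S i).
Proof.
move=> c x Dx; rewrite frE [in RHS]addmxE [in RHS]oppmxE [in RHS]scalemxE evB evM.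
by rewrite -!(reprV_coord _ _ Dx) -repr_A /delta addmxE oppmxE scalemxE.
Qed.

Lemma repr_di i f F : repr f F -> repr (along (delta g Phi i) f) (dirder S (fr S i) F).
Proof. exact: repr_along (reprV_delta i). Qed.

Lemma repr_d0 f F : repr f F -> repr (partial 0 f) (dirder S (ecoord 0) F).
Proof. exact: repr_along reprV_xi. Qed.

Lemma repr_omega i j : repr (omega g Phi i j) (vort S i j).
Proof.
move=> x Dx; rewrite vortE evM evB ev_half.
by rewrite -(repr_di i (repr_A j)) -(repr_di j (repr_A i)).
Qed.

Lemma repr_a i : repr (a_ g Phi i) (acc_a S i).
Proof. by move=> x Dx; rewrite acc_aE evN -(repr_d0 (repr_A i)). Qed.

Lemma repr_Phi : repr Phi (lapse S).
Proof. by move=> x Dx; rewrite ev_lapse. Qed.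

Lemma repr_c i : repr (c_ g Phi i) (acc_c S i).
Proof. by move=> x Dx; rewrite acc_cE evM ev_lapseI -(repr_di i repr_Phi). Qed.

Lemma repr_b i : repr (b_ g Phi i) (acc_b S i).
Proof. by move=> x Dx; rewrite acc_bE evD -repr_a -repr_c. Qed.

Lemma repr_Psi : repr (Psi Phi) (psi S).
Proof. by move=> x Dx; rewrite psiE evM ev_lapseI -(repr_d0 repr_Phi). Qed.

Lemma repr_gbar i j : repr (gbar g Phi i j) (gb S i j).
Proof.
move=> x Dx; rewrite gbE -(repr_bilin (reprV_delta i) (reprV_delta j)).
by rewrite /gbar mxE.
Qed.

(** Both are inverses of the matrix gbar, the algebraic one by [gbK]. *)
Lemma repr_gbar_inv i j : repr (gbar_inv g Phi i j) (gbi S i j).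
Proof.
move=> x Dx; rewrite /gbar_inv.
pose BI := map_mx (ev Dx) (form_mx (gbi S)).
have e : gbar_mx g Phi x *m BI = 1%:M.
  rewrite (_ : gbar_mx g Phi x = map_mx (ev Dx) (form_mx (gb S))).
    by rewrite -map_mxM mulBBI map_mx1.
  apply/matrixP => k l; rewrite [RHS]mxE [X in ev _ X]mxE -repr_gbar.
  by [].
have [u _] := mulmx1_unit e.
by rewrite -[invmx _]mulmx1 -e mulKmx // !mxE.
Qed.

Lemma repr_Theta2 i j : repr (Theta_ g Phi i j) (expn S i j).
Proof. by move=> x Dx; rewrite expnE evM ev_half -(repr_d0 (repr_gbar i j)). Qed.

Lemma repr_trace T TA : (forall i j, repr (T i j) (TA i j)) ->
  repr (gbar_trace g Phi T) (contract S TA).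
Proof.
move=> rT x Dx; rewrite /contract ev_sum; apply: eq_bigr => i _; rewrite ev_sum.
by apply: eq_bigr => j _; rewrite evM -repr_gbar_inv -rT.
Qed.

Lemma repr_Theta : repr (Theta g Phi) (expansion S).
Proof. by rewrite -contract_expn; exact: repr_trace repr_Theta2. Qed.

Lemma repr_K i j : repr (K_ g Phi i j) (Kl S i j).
Proof.
by move=> x Dx; rewrite KlE evD evM evX ev_lapse -repr_Theta2 -repr_omega.
Qed.

Lemma repr_raise1 v vA : (forall i, repr (v i) (vA i)) ->
  forall k, repr (raise1 g Phi v k) (up1 S vA k).
Proof.
move=> rv k x Dx; rewrite /up1 ev_sum; apply: eq_bigr => i _.
by rewrite evM -repr_gbar_inv -rv.
Qed.

Lemma repr_raise T TA : (forall i j, repr (T i j) (TA i j)) ->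
  forall k j, repr (raise_first g Phi T k j) (up S TA k j).
Proof.
move=> rT k j x Dx; rewrite /up ev_sum; apply: eq_bigr => i _.
by rewrite evM -repr_gbar_inv -rT.
Qed.

Lemma repr_sqnorm2 T TA : (forall i j, repr (T i j) (TA i j)) ->
  repr (sqnorm2 g Phi T) (sqn S TA).
Proof.
move=> rT x Dx; rewrite /sqn ev_sum; apply: eq_bigr => k _; rewrite ev_sum.
apply: eq_bigr => l _; rewrite evM -rT ev_sum; congr (_ * _).
apply: eq_bigr => i _; rewrite ev_sum; apply: eq_bigr => j _.
by rewrite !evM -!repr_gbar_inv -rT.
Qed.

Lemma repr_Gamma i k j : repr (Gamma_bar g Phi i k j) (Gb S i k j).
Proof.
move=> x Dx; rewrite GbE evM ev_half ev_sum; congr (_ * _); apply: eq_bigr => l _.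
rewrite evM evB evD -repr_gbar_inv -(repr_di i (repr_gbar l j)).
by rewrite -(repr_di j (repr_gbar l i)) -(repr_di l (repr_gbar i j)).
Qed.

Lemma repr_cov_low w wA : (forall i, repr (w i) (wA i)) ->
  forall i j, repr (cov_low g Phi w i j) (hcov_low S wA i j).
Proof.
move=> rw i j x Dx; rewrite hcov_lowE evB ev_sum -(repr_di j (rw i)); congr (_ - _).
by apply: eq_bigr => l _; rewrite evM -rw -repr_Gamma.
Qed.

Lemma repr_cov_up v vA : (forall i, repr (v i) (vA i)) ->
  forall i j, repr (cov_up g Phi v i j) (hcov_up S vA i j).
Proof.
move=> rv i j x Dx; rewrite hcov_upE evD ev_sum -(repr_di j (rv i)); congr (_ + _).
by apply: eq_bigr => l _; rewrite evM -rv -repr_Gamma.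
Qed.

Lemma repr_cov_mixed T TA : (forall i j, repr (T i j) (TA i j)) ->
  forall j i k, repr (cov_mixed g Phi T j i k) (hcov_mixed S TA j i k).
Proof.
move=> rT j i k x Dx; rewrite hcov_mixedE evB evD !ev_sum -(repr_di k (rT j i)).
by congr (_ + _ - _); apply: eq_bigr => l _; rewrite evM -rT -repr_Gamma.
Qed.

Lemma repr_cov0 T TA : (forall i j, repr (T i j) (TA i j)) ->
  forall i j, repr (cov0_low2 g Phi T i j) (vcov_low2 S TA i j).
Proof.
move=> rT i j x Dx; rewrite vcov_low2E !evB !ev_sum -(repr_d0 (rT i j)).
by congr (_ - _ - _); apply: eq_bigr => l _; rewrite evM -rT -(repr_raise repr_K).
Qed.

(** The coefficient g(X, xi) / g(xi, xi) of the projection is the one-form [thet]. *)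
Lemma reprV_proj X XA : reprV X XA ->
  reprV (spatial_proj g X) (XA - thet S XA *: ecoord 0).
Proof.
move=> rX c x Dx; rewrite [in RHS]addmxE [in RHS]oppmxE [in RHS]scalemxE evB evM.
rewrite -rX -(reprV_coord _ _ Dx).
rewrite 3!mxE (repr_bilin rX reprV_xi) (repr_bilin reprV_xi reprV_xi).
rewrite gg00 {1}(vecK S XA) gg_vec0 evM evN evX ev_lapse.
by congr (_ - _ * _); rewrite mulrAC divff ?mul1r // oppr_eq0 expf_neq0 // (Phi_neq0 H).
Qed.

Lemma reprV_nabla_bar X Y XA YA : reprV X XA -> reprV Y YA ->
  reprV (nabla_bar g X Y) (barconn S XA YA).
Proof.
by move=> rX rY; rewrite /barconn -lock; exact: reprV_proj (reprV_nabla rX rY).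
Qed.

Lemma reprV_proj_delta i : reprV (spatial_proj g (delta g Phi i)) (fr S i).
Proof.
have := reprV_proj (reprV_delta i).
have -> : thet S (fr S i) = 0.
  rewrite /thet fr0; under eq_bigr do rewrite frS mulrC.
  by rewrite sum_kron addNr.
by rewrite scale0r subr0.
Qed.

Lemma repr_Rbar i j k l : repr (Rbar g Phi i j k l) (Rb S i j k l).
Proof.
move=> x Dx; rewrite /Rb -lock /barriem.
exact: (reprV_curvature reprV_nabla_bar (reprV_delta l) (reprV_delta k) (reprV_proj_delta i)).
Qed.

Lemma repr_Rbar0 i j k : repr (Rbar0 g Phi i j k) (Rb0 S i j k).
Proof.
move=> x Dx; rewrite /Rb0 -lock /barriem.
exact: (reprV_curvature reprV_nabla_bar (reprV_delta k) reprV_xi (reprV_proj_delta i)).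
Qed.

Lemma repr_ricci_bar i j : repr (ricci_bar g Phi i j) (ricbar S i j).
Proof.
move=> x Dx; rewrite ricbarE evM ev_half evD !ev_sum; congr (_ * (_ + _)).
  by apply: eq_bigr => k _; rewrite -repr_Rbar.
by apply: eq_bigr => k _; rewrite -repr_Rbar.
Qed.

End Model.

(** * The field equations, component by component *)

Section Components.
Context {R : realType} (D : set 'rV[R]_4) (oD : open D).
Context (g : 'rV[R]_4 -> 'M[R]_4) (Phi : 'rV[R]_4 -> R) (H : threaded_metric D g Phi).
Local Notation S := (model oD H).
Local Notation point := 'rV[R]_4.

Lemma repr_sigma i j : repr (sigma g Phi i j)
  (expn S i j - cstS oD 3^-1 * expansion S * gb S i j).
Proof.
move=> x Dx; rewrite evB !evM ev_mks -(repr_Theta2 oD H) -(repr_Theta oD H) -(repr_gbar oD H).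
by [].
Qed.

(** Trades sigma^2 for Theta_hk Theta^hk, the form in which the curvature computation
    produces it. *)
Lemma sqnorm2_sigma x : D x -> sqnorm2 g Phi (sigma g Phi) x =
  sqnorm2 g Phi (Theta_ g Phi) x - 3^-1 * Theta g Phi x ^+ 2.
Proof.
move=> Dx; rewrite (repr_sqnorm2 H repr_sigma) (repr_sqnorm2 H (repr_Theta2 oD H)) sqn_shear.
rewrite evD evB !(evX, evM) !ev_nat ev_mks -(repr_Theta oD H).
by field.
Qed.

Lemma repr_scalar_bar : repr (scalar_bar g Phi) (contract S (ricbar S)).
Proof. exact: (repr_trace H (repr_ricci_bar oD H)). Qed.

Lemma repr_b_sq : repr (b_sq g Phi) (b2 S).
Proof.
move=> x Dx; rewrite /b2 ev_sum; apply: eq_bigr => k _.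
by rewrite evM -(repr_b oD H) -(repr_raise1 H (repr_b oD H)).
Qed.

Lemma repr_div_b :
  repr (fun x => \sum_k cov_up g Phi (raise1 g Phi (b_ g Phi)) k k x) (div_b S).
Proof.
move=> x Dx; rewrite /div_b ev_sum; apply: eq_bigr => k _.
exact: (repr_cov_up H (repr_raise1 H (repr_b oD H)) k k Dx).
Qed.

Lemma einstein_spatial i j x : D x ->
  einstein_tensor g (delta g Phi i) (delta g Phi j) x =
  einstein_bar g Phi i j x
  + (b_sq g Phi x + \sum_k cov_up g Phi (raise1 g Phi (b_ g Phi)) k k x
     + 2^-1 * Phi x ^+ 2 * sqnorm2 g Phi (omega g Phi) x) * gbar g Phi i j x
  - 2^-1 * (cov_low g Phi (b_ g Phi) i j x + cov_low g Phi (b_ g Phi) j i x)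
  - b_ g Phi i x * b_ g Phi j x
  + Phi x ^- 2 *
    ((Theta g Phi x - Psi Phi x) * Theta_ g Phi i j x
     + cov0_low2 g Phi (Theta_ g Phi) i j x
     - (partial 0 (Theta g Phi) x - Psi Phi x * Theta g Phi x + 2 / 3 * Theta g Phi x ^+ 2
        + 2^-1 * sqnorm2 g Phi (sigma g Phi) x) * gbar g Phi i j x).
Proof.
move=> Dx; rewrite sqnorm2_sigma //.
rewrite (repr_einstein H (reprV_delta oD H i) (reprV_delta oD H j)) ein_spatial.
rewrite !(evX, evN, evD, evM, ev_half, ev_lapse, ev_lapseI).
rewrite -(repr_ricci_bar oD H).
rewrite -repr_scalar_bar -(repr_gbar oD H) -repr_b_sq -repr_div_b.
rewrite -(repr_sqnorm2 H (repr_omega oD H)) -!(repr_cov_low H (repr_b oD H)) -!(repr_b oD H).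
rewrite -(repr_Theta oD H) -(repr_Psi oD H) -(repr_Theta2 oD H) -(repr_cov0 H (repr_Theta2 oD H)).
rewrite -(repr_d0 H (repr_Theta oD H)) -(repr_sqnorm2 H (repr_Theta2 oD H)) /einstein_bar exprVn.
(* Abstracting the geometric quantities leaves an identity of rational functions. *)
move: (Phi_neq0 H Dx).
move: (ricci_bar g Phi i j x) (scalar_bar g Phi x) (b_sq g Phi x) (gbar g Phi i j x).
move: (\sum_k _) (sqnorm2 g Phi (omega g Phi) x) (sqnorm2 g Phi (Theta_ g Phi) x).
move: (cov_low g Phi _ i j x) (cov_low g Phi _ j i x) (b_ g Phi i x) (b_ g Phi j x).
move: (cov0_low2 g Phi _ i j x) (Theta_ g Phi i j x) (partial 0 (Theta g Phi) x).
move: (Theta g Phi x) (Psi Phi x) (Phi x) => ? ? ? ? ? ? ? ? ? ? ? ? ? ? ? ? ? Phi0.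
by field.
Qed.

Lemma einstein_mixed1 i x : D x ->
  einstein_tensor g xi (delta g Phi i) x =
  \sum_k Rbar0 g Phi i k k x + Theta g Phi x * b_ g Phi i x
  - \sum_k Theta_ g Phi i k x * raise1 g Phi (b_ g Phi) k x
  - Phi x ^+ 2 * \sum_k omega g Phi i k x * raise1 g Phi (b_ g Phi) k x.
Proof.
move=> Dx; rewrite (repr_einstein H (reprV_xi oD) (reprV_delta oD H i)) ein_mixed.
rewrite evB evD !ev_sum evM -(repr_Theta oD H) -(repr_b oD H) -[RHS]addrA -opprD.
congr (_ + _ - _); first by apply: eq_bigr => k _; rewrite -(repr_Rbar0 oD H).
rewrite mulr_sumr -big_split; apply: eq_bigr => k _ /=.
by rewrite evM -(repr_K oD H) -(repr_raise1 H (repr_b oD H)) /K_ mulrDl mulrA.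
Qed.

Lemma einstein_mixed2 i x : D x ->
  einstein_tensor g xi (delta g Phi i) x =
  \sum_k cov_mixed g Phi (raise_first g Phi (Theta_ g Phi)) k i k x
  - along (delta g Phi i) (Theta g Phi) x
  + Theta g Phi x * c_ g Phi i x - \sum_k Theta_ g Phi i k x * raise1 g Phi (c_ g Phi) k x
  + Phi x ^+ 2 *
    (\sum_k cov_mixed g Phi (raise_first g Phi (omega g Phi)) k i k x
     + \sum_k c_ g Phi k x * raise_first g Phi (omega g Phi) k i x
     - 2 * \sum_k omega g Phi i k x * raise1 g Phi (b_ g Phi) k x).
Proof.
move=> Dx; rewrite (repr_einstein H (reprV_xi oD) (reprV_delta oD H i)) ein_mixed mixed_forms.
rewrite !(ev_nat, evX, evN, evD, evM, ev_sum, ev_lapse).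
rewrite -(repr_Theta oD H) -(repr_di H i (repr_Theta oD H)) -(repr_c oD H).
congr (_ - _ + _ - _ + _ * (_ + _ - 2 * _)); apply: eq_bigr => k _.
- by rewrite -(repr_cov_mixed H (repr_raise H (repr_Theta2 oD H))).
- by rewrite evM -(repr_Theta2 oD H) -(repr_raise1 H (repr_c oD H)).
- by rewrite -(repr_cov_mixed H (repr_raise H (repr_omega oD H))).
- by rewrite evM -(repr_c oD H) -(repr_raise H (repr_omega oD H)).
- by rewrite evM -(repr_omega oD H) -(repr_raise1 H (repr_b oD H)).
Qed.

Lemma einstein_temporal x : D x -> 2 * einstein_tensor g xi xi x =
  Phi x ^+ 2 * scalar_bar g Phi x + 2 / 3 * Theta g Phi x ^+ 2
  - sqnorm2 g Phi (sigma g Phi) x + Phi x ^+ 4 * sqnorm2 g Phi (omega g Phi) x.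
Proof.
move=> Dx; rewrite sqnorm2_sigma // (repr_einstein H (reprV_xi oD) (reprV_xi oD)).
rewrite -(ev_nat oD Dx 2) -evM ein_temporal.
rewrite !(evX, evN, evD, evM, ev_lapse) -repr_scalar_bar -(repr_Theta oD H).
rewrite -(repr_sqnorm2 H (repr_Theta2 oD H)) -(repr_sqnorm2 H (repr_omega oD H)).
move: (scalar_bar g Phi x) (sqnorm2 g Phi (omega g Phi) x) (sqnorm2 g Phi (Theta_ g Phi) x).
by move: (Theta g Phi x) (Phi x) => ? ? ? ? ?; field.
Qed.

(** The matrix of the Einstein tensor at a point: by tensoriality its value on vector
    fields depends only on their values there. *)
Definition einstein_mx (x : point) : 'M[R]_4 :=
  \matrix_(a, b) einstein_tensor g (coord_field a) (coord_field b) x.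

Lemma einstein_mxE x (Dx : D x) a b :
  einstein_mx x a b = ev Dx (ein S (ecoord a) (ecoord b)).
Proof.
by rewrite mxE (repr_einstein H (reprV_coord oD a) (reprV_coord oD b)).
Qed.

Lemma einstein_mx_sym x : D x -> (einstein_mx x)^T = einstein_mx x.
Proof.
by move=> Dx; apply/matrixP => a b; rewrite [LHS]mxE !(einstein_mxE Dx) einC.
Qed.

Lemma einstein_bilin X Y x : smooth_mx_on D X -> smooth_mx_on D Y -> D x ->
  einstein_tensor g X Y x = bilin einstein_mx X Y x.
Proof.
move=> sX sY Dx.
pose XA : 'rV[sfun oD]_4 := \row_c mks oD (sX 0 c).
pose YA : 'rV[sfun oD]_4 := \row_c mks oD (sY 0 c).
have rX : reprV X XA by move=> c y Dy; rewrite mxE ev_mks.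
have rY : reprV Y YA by move=> c y Dy; rewrite mxE ev_mks.
rewrite (repr_einstein H rX rY Dx) ein_expand ev_sum /bilin -mulmxA mxE.
apply: eq_bigr => a _; rewrite ev_sum [(_ *m _) a 0]mxE mulr_sumr; apply: eq_bigr => b _.
by rewrite !evM -rX -rY -einstein_mxE [_^T b 0]mxE; ring.
Qed.

Lemma smooth_delta i : smooth_mx_on D (delta g Phi i).
Proof. by move=> k c; rewrite (ord1 k); exact: (repr_smooth (reprV_delta oD H i c)). Qed.

End Components.

Lemma smooth_xi (R : realType) (D : set 'rV[R]_4) : open D -> smooth_mx_on D xi.
Proof. by move=> oD k c; rewrite (ord1 k); exact: (repr_smooth (reprV_xi oD c)). Qed.

(** The frame spans, as d_i = delta_i + A_i xi; symmetry carries linearity over to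
    the second argument, so the vanishing on the frame spreads one slot at a time. *)
Lemma frame_vanish (R : realType) (g : 'rV[R]_4 -> 'M[R]_4) (Phi : 'rV[R]_4 -> R)
    (x : 'rV[R]_4) (B : 'rV[R]_4 -> 'rV[R]_4 -> R) :
  (forall k v v' w, B (k *: v + v') w = k * B v w + B v' w) ->
  (forall v w, B v w = B w v) ->
  (forall i j, B (delta g Phi i x) (delta g Phi j x) = 0) ->
  (forall i, B (xi x) (delta g Phi i x) = 0) -> B (xi x) (xi x) = 0 ->
  forall v w, B v w = 0.
Proof.
move=> Blin Bsym Bss B0s B00.
have B0 w : B 0 w = 0.
  have := Blin (-1) w w w; rewrite scaleN1r addNr => ->.
  by rewrite mulN1r addNr.
have span (L : 'rV[R]_4 -> Prop) : L 0 ->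
    (forall k v v', L v -> L v' -> L (k *: v + v')) ->
    (forall i, L (delta g Phi i x)) -> L (xi x) -> forall v, L v.
  move=> L0 Llin Ls Lx v; rewrite [v]row_sum_delta.
  apply: big_ind => // [u u' Lu Lu'|a _]; first by rewrite -[u]scale1r; exact: Llin.
  rewrite -[_ *: _]addr0; apply: (Llin) => //.
  have [i|] := unliftP ord0 a; last by move=> ->.
  move=> ->; have -> : delta_mx 0 (lift ord0 i) = A_ g Phi i x *: xi x + delta g Phi i x.
    by rewrite /delta addrC subrK.
  exact: Llin.
have Bx v : B (xi x) v = 0.
  apply: (span (fun v => B (xi x) v = 0)) => // [|k u u' hu hu']; first by rewrite Bsym.
  by rewrite Bsym Blin ![B _ (xi x)]Bsym hu hu' mulr0 addr0.
have Bs i v : B (delta g Phi i x) v = 0.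
  apply: (span (fun v => B (delta g Phi i x) v = 0)) => // [|k u u' hu hu'|].
  - by rewrite Bsym.
  - by rewrite Bsym Blin ![B _ (delta _ _ _ _)]Bsym hu hu' mulr0 addr0.
  - by rewrite Bsym.
move=> v w; apply: (span (fun v => B v w = 0)) => // k u u' hu hu'.
by rewrite Blin hu hu' mulr0 addr0.
Qed.

(** * The energy-momentum tensor in the adapted frame *)

Section Matter.
Context {R : realType} (D : set 'rV[R]_4) (oD : open D).
Context (g : 'rV[R]_4 -> 'M[R]_4) (Phi : 'rV[R]_4 -> R) (H : threaded_metric D g Phi).
Context (rho p : 'rV[R]_4 -> R) (q : 'rV[R]_4 -> 'rV[R]_4) (pi_ : 'rV[R]_4 -> 'M[R]_4).
Context (q_spatial : spatial_oneform g q D).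
Context (pi_spatial : spatial_symmetric_tracefree g Phi pi_ D).
Local Notation T := (energy_momentum g Phi rho p q pi_).
Local Notation point := 'rV[R]_4.
Implicit Types (X Y Z : point -> point).

Lemma bilinC (B : point -> 'M[R]_4) X Y x : (B x)^T = B x -> bilin B X Y x = bilin B Y X x.
Proof.
move=> BT; rewrite /bilin.
transitivity ((X x *m B x *m (Y x)^T)^T 0 0); first by rewrite [RHS]mxE.
by rewrite !trmx_mul trmxK BT mulmxA.
Qed.

Lemma energy_momentum_sym X Y x : D x -> T X Y x = T Y X x.
Proof.
move=> Dx; have [piT _ _] := pi_spatial.
rewrite /energy_momentum (bilinC X Y (piT x Dx)).
rewrite (bilinC (spatial_proj g X) _ (g_sym H Dx)); ring.
Qed.

Lemma energy_momentum_lin k X X' Y x :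
  T (fun y => k *: X y + X' y) Y x = k * T X Y x + T X' Y x.
Proof.
have bl (B : point -> 'M[R]_4) V V' W : bilin B (fun y => k *: V y + V' y) W x =
    k * bilin B V W x + bilin B V' W x.
  by rewrite /bilin !mulmxDl -!scalemxAl addmxE scalemxE.
have ql : covector_eval q (fun y => k *: X y + X' y) x =
    k * covector_eval q X x + covector_eval q X' x.
  by rewrite /covector_eval mulmxDl -scalemxAl addmxE scalemxE.
have sl : bilin g (spatial_proj g (fun y => k *: X y + X' y)) (spatial_proj g Y) x =
    k * bilin g (spatial_proj g X) (spatial_proj g Y) x
    + bilin g (spatial_proj g X') (spatial_proj g Y) x.
  have -> : bilin g (spatial_proj g (fun y => k *: X y + X' y)) (spatial_proj g Y) x =
      bilin g (fun y => k *: spatial_proj g X y + spatial_proj g X' y) (spatial_proj g Y) x.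
    rewrite /bilin; congr ((_ *m _ *m _) 0 0); rewrite /spatial_proj bl.
    apply/rowP => c; rewrite !(addmxE, oppmxE, scalemxE); ring.
  exact: bl.
rewrite /energy_momentum /u_form !bl ql sl; ring.
Qed.

Lemma spatial_proj_xi x : D x -> spatial_proj g xi x = 0.
Proof.
move=> Dx; rewrite /spatial_proj divff ?scale1r ?subrr //.
rewrite (repr_bilin H (reprV_xi oD) (reprV_xi oD) Dx) gg00 evN evX ev_lapse.
by rewrite oppr_eq0 expf_neq0 // (Phi_neq0 H).
Qed.

Lemma spatial_proj_delta i x : D x -> spatial_proj g (delta g Phi i) x = delta g Phi i x.
Proof.
move=> Dx; apply/rowP => c.
by rewrite (reprV_proj_delta oD H i c Dx) (reprV_delta oD H i c Dx).
Qed.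

Lemma bilin0l (B : point -> 'M[R]_4) X Y x : X x = 0 -> bilin B X Y x = 0.
Proof. by move=> X0; rewrite /bilin X0 !mul0mx mxE. Qed.

(** A spatial tensor sees only the spatial projection, which kills xi. *)
Lemma pi_xi X x : smooth_mx_on D X -> D x -> bilin pi_ xi X x = 0.
Proof.
move=> sX Dx; have [_ pis _] := pi_spatial.
by rewrite pis //; [exact: bilin0l (spatial_proj_xi Dx)|exact: smooth_xi].
Qed.

Lemma q_xi x : D x -> covector_eval q xi x = 0.
Proof.
move=> Dx; rewrite q_spatial //; last exact: smooth_xi.
by rewrite /covector_eval spatial_proj_xi // mul0mx mxE.
Qed.

Lemma bilin_xi_xi x : D x -> bilin g xi xi x = - Phi x ^+ 2.
Proof.
by move=> Dx; rewrite (repr_bilin H (reprV_xi oD) (reprV_xi oD) Dx) gg00 evN evX ev_lapse.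
Qed.

Lemma bilin_xi_delta i x : D x -> bilin g xi (delta g Phi i) x = 0.
Proof.
by move=> Dx; rewrite (repr_bilin H (reprV_xi oD) (reprV_delta oD H i) Dx) gg_0fr (ev_nat oD Dx 0).
Qed.

Lemma u_xi x : D x -> u_form g Phi xi x = - Phi x.
Proof.
by move=> Dx; rewrite /u_form bilin_xi_xi //; field; exact: (Phi_neq0 H).
Qed.

Lemma u_delta i x : D x -> u_form g Phi (delta g Phi i) x = 0.
Proof.
by move=> Dx; rewrite /u_form (bilinC _ _ (g_sym H Dx)) bilin_xi_delta // mulr0.
Qed.

Lemma energy_momentum_00 x : D x -> T xi xi x = rho x * Phi x ^+ 2.
Proof.
move=> Dx; rewrite /energy_momentum u_xi // q_xi // pi_xi //; last exact: smooth_xi.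
by rewrite (bilin0l _ _ (spatial_proj_xi Dx)); ring.
Qed.

Lemma energy_momentum_0s i x : D x ->
  T xi (delta g Phi i) x = - (Phi x * q_ g Phi q i x).
Proof.
move=> Dx; rewrite /energy_momentum u_xi // u_delta // q_xi // pi_xi //.
  by rewrite (bilin0l _ _ (spatial_proj_xi Dx)) /q_; ring.
exact: smooth_delta.
Qed.

Lemma energy_momentum_ss i j x : D x -> T (delta g Phi i) (delta g Phi j) x =
  p x * gbar g Phi i j x + pi_comp g Phi pi_ i j x.
Proof.
move=> Dx; have [piT _ _] := pi_spatial.
rewrite /energy_momentum !u_delta // /pi_comp (bilinC (delta g Phi j) _ (piT x Dx)).
rewrite /gbar mxE [bilin g (spatial_proj _ _) _ _]/bilin !spatial_proj_delta //.
by rewrite -[(_ *m _ *m _) 0 0]/(bilin g (delta g Phi i) (delta g Phi j) x); ring.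
Qed.

Context (Lambda GN : R).

Definition field_eq X Y x : Prop :=
  einstein_tensor g X Y x + Lambda * bilin g X Y x = 8 * pi * GN * T X Y x.

(** At each point the difference of the two sides is a symmetric bilinear form in the
    values of X and Y, to which [frame_vanish] applies. *)
Lemma einstein_field_equations_frame :
  einstein_field_equations g Phi rho p q pi_ Lambda GN D <->
  [/\ forall i j x, D x -> field_eq (delta g Phi i) (delta g Phi j) x,
      forall i x, D x -> field_eq xi (delta g Phi i) x
    & forall x, D x -> field_eq xi xi x].
Proof.
have sx := smooth_xi oD; have sd := smooth_delta oD H.
split=> [efe|[ess e0s e00] X Y sX sY x Dx].
  by split=> *; apply: efe.
(* Tangent vectors at x are extended to constant vector fields. *)
pose B (v w : point) := bilin (einstein_mx g) (fun=> v) (fun=> w) x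
  + Lambda * bilin g (fun=> v) (fun=> w) x - 8 * pi * GN * T (fun=> v) (fun=> w) x.
have BE Z W : smooth_mx_on D Z -> smooth_mx_on D W -> field_eq Z W x -> B (Z x) (W x) = 0.
  move=> sZ sW; rewrite /field_eq (einstein_bilin oD H sZ sW Dx) => e.
  by apply/eqP; rewrite /B subr_eq0; apply/eqP.
suff e : B (X x) (Y x) = 0.
  by move/eqP: e; rewrite /B subr_eq0 => /eqP; rewrite (einstein_bilin oD H sX sY Dx).
apply: (@frame_vanish R g Phi x B) => [k v v' w|v w|i j|i|].
- rewrite /B (energy_momentum_lin k (fun=> v) (fun=> v')).
  by rewrite /bilin !mulmxDl -!scalemxAl !addmxE !scalemxE; ring.
- rewrite /B (energy_momentum_sym (fun=> v)) // (bilinC (fun=> v) _ (g_sym H Dx)).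
  by rewrite (bilinC (fun=> v) _ (einstein_mx_sym oD H Dx)).
- by apply: BE => //; exact: ess.
- by apply: BE => //; exact: e0s.
- by apply: BE => //; exact: e00.
Qed.

Lemma field_eq_spatial i j x : D x -> field_eq (delta g Phi i) (delta g Phi j) x <->
  spatial_equation g Phi p pi_ Lambda GN i j x.
Proof.
move=> Dx; rewrite /field_eq /spatial_equation (einstein_spatial oD H) //.
rewrite energy_momentum_ss // (_ : bilin g _ _ x = gbar g Phi i j x); last by rewrite /gbar mxE.
set l := (X in X = _ <-> _); set l' := (X in _ <-> X = _).
suff -> : l = l' by [].
have shuffle (r b m c d f k : R) :
    r + b * m - c - d + f + k * m = r + (b + k) * m - c - d + f by ring.
exact: shuffle.
Qed.

Lemma field_eq_mixed1 i x : D x -> field_eq xi (delta g Phi i) x <->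
  mixed_equation1 g Phi q GN i x.
Proof.
move=> Dx; rewrite /field_eq /mixed_equation1 (einstein_mixed1 oD H) // bilin_xi_delta //.
by rewrite energy_momentum_0s // mulr0 addr0 mulrN [8 * pi * GN * (_ * _)]mulrA.
Qed.

Lemma field_eq_mixed2 i x : D x -> field_eq xi (delta g Phi i) x <->
  mixed_equation2 g Phi q GN i x.
Proof.
move=> Dx; rewrite /field_eq /mixed_equation2 (einstein_mixed2 oD H) // bilin_xi_delta //.
by rewrite energy_momentum_0s // mulr0 addr0 mulrN [8 * pi * GN * (_ * _)]mulrA.
Qed.

Lemma field_eq_temporal x : D x -> field_eq xi xi x <->
  temporal_equation g Phi rho Lambda GN x.
Proof.
move=> Dx; rewrite /field_eq /temporal_equation -(einstein_temporal oD H) // bilin_xi_xi //.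
rewrite energy_momentum_00 //; move: (einstein_tensor g xi xi x) => e; split=> h; lra.
Qed.

End Matter.

(** * The splitting theorem *)

(** A matrix congruent to the Minkowski matrix has nonzero determinant. *)
Lemma lorentzian_threaded (R : realType) (D : set 'rV[R]_4) (g : 'rV[R]_4 -> 'M[R]_4)
    (Phi : 'rV[R]_4 -> R) :
  lorentzian_on D g -> smooth_on D Phi -> (forall x, D x -> Phi x != 0) ->
  (forall x, D x -> bilin g xi xi x = - Phi x ^+ 2) -> threaded_metric D g Phi.
Proof.
move=> [sg lor] sPhi Phi0 gxi; split=> // x Dx; first by have [] := lor x Dx.
- have [_ [P _ PgP]] := lor x Dx.
  have det_mink : \det (Defs.minkowski : 'M[R]_4) != 0.
    rewrite /Defs.minkowski det_diag prodf_seq_neq0; apply/allP => a _; rewrite mxE.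
    by case: ifP; rewrite ?oppr_eq0 oner_eq0.
  rewrite unitmxE unitfE; apply: contraNneq det_mink => g0.
  by rewrite -PgP !det_mulmx g0 mulr0 mul0r.
- by rewrite -gxi // /bilin /xi /coord_field -rowE trmx_delta -colE !mxE.
Qed.

Theorem mainTheorem1 (R : realType) (D : set 'rV[R]_4)
    (g : 'rV[R]_4 -> 'M[R]_4) (Phi rho p : 'rV[R]_4 -> R)
    (q : 'rV[R]_4 -> 'rV[R]_4) (pi_ : 'rV[R]_4 -> 'M[R]_4) (Lambda GN : R)
    (D_open : open D)
    (g_lorentzian : lorentzian_on D g)
    (Phi_smooth : smooth_on D Phi)
    (Phi_neq0 : forall x, D x -> Phi x != 0)
    (g_xi_xi : forall x, D x -> bilin g xi xi x = - Phi x ^+ 2)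
    (rho_smooth : smooth_on D rho) (p_smooth : smooth_on D p)
    (q_smooth : smooth_mx_on D q) (pi_smooth : smooth_mx_on D pi_)
    (q_spatial : spatial_oneform g q D)
    (pi_spatial : spatial_symmetric_tracefree g Phi pi_ D) :
  (einstein_field_equations g Phi rho p q pi_ Lambda GN D <->
   [/\ forall i j x, D x -> spatial_equation g Phi p pi_ Lambda GN i j x,
       forall i x, D x -> mixed_equation1 g Phi q GN i x
     & forall x, D x -> temporal_equation g Phi rho Lambda GN x])
  /\
  (einstein_field_equations g Phi rho p q pi_ Lambda GN D <->
   [/\ forall i j x, D x -> spatial_equation g Phi p pi_ Lambda GN i j x,
       forall i x, D x -> mixed_equation2 g Phi q GN i x
     & forall x, D x -> temporal_equation g Phi rho Lambda GN x]).
Proof.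
have H := lorentzian_threaded g_lorentzian Phi_smooth Phi_neq0 g_xi_xi.
have frame := einstein_field_equations_frame D_open H rho p q pi_spatial Lambda GN.
have ess i j x (Dx : D x) := field_eq_spatial D_open H rho p q pi_spatial Lambda GN i j Dx.
have e1 i x (Dx : D x) := field_eq_mixed1 D_open H rho p q_spatial pi_spatial Lambda GN i Dx.
have e2 i x (Dx : D x) := field_eq_mixed2 D_open H rho p q_spatial pi_spatial Lambda GN i Dx.
have e0 x (Dx : D x) := field_eq_temporal D_open H rho p q_spatial pi_spatial Lambda GN Dx.
split.
- apply: (iff_trans frame); split=> -[hs hm h0]; split=> [i j x Dx|i x Dx|x Dx].
  + by have [to _] := ess i j x Dx; exact: to (hs i j x Dx).
  + by have [to _] := e1 i x Dx; exact: to (hm i x Dx).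
  + by have [to _] := e0 x Dx; exact: to (h0 x Dx).
  + by have [_ from] := ess i j x Dx; exact: from (hs i j x Dx).
  + by have [_ from] := e1 i x Dx; exact: from (hm i x Dx).
  + by have [_ from] := e0 x Dx; exact: from (h0 x Dx).
- apply: (iff_trans frame); split=> -[hs hm h0]; split=> [i j x Dx|i x Dx|x Dx].
  + by have [to _] := ess i j x Dx; exact: to (hs i j x Dx).
  + by have [to _] := e2 i x Dx; exact: to (hm i x Dx).
  + by have [to _] := e0 x Dx; exact: to (h0 x Dx).
  + by have [_ from] := ess i j x Dx; exact: from (hs i j x Dx).
  + by have [_ from] := e2 i x Dx; exact: from (hm i x Dx).
  + by have [_ from] := e0 x Dx; exact: from (h0 x Dx).
Qed.
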